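(* Let $(G,K)$ be a compact Gelfand pair, let $X$ be a non-empty set, and let $f:G\times X^2\to\mathbb{C}$. The following are equivalent: (i) $f\in\mathcal P^\sharp_K(G,X^2)$; (ii) $f$ has a series representation $$f(x,u,v)=\sum_{\varphi\in Z}B(\varphi)(u,v)\varphi(x),\qquad x\in G,\ (u,v)\in X^2,$$ where each $B(\varphi)$ is a positive definite kernel on $X$ and $\sum_{\varphi\in Z}B(\varphi)(u,u)<\infty$ for each $u\in X$. Moreover, for $f\in\mathcal P^\sharp_K(G,X^2)$ one has $$B(\varphi)(u,v)=\delta(\varphi)\int_G f(x,u,v)\overline{\varphi(x)}\,d\omega_G(x),\qquad (u,v)\in X^2.$$
   Context: A kernel $k:Y^2\to\mathbb{C}$ on a set $Y$ is positive definite if $\sum_{j,k=1}^n k(y_j,y_k)c_j\overline{c_k}\ge0$ for all $n$, $y_j\in Y$, $c_j\in\mathbb{C}$. For a group $H$, a continuous $g:H\to\mathbb{C}$ is positive definite if the kernel $(x,y)\mapsto g(x^{-1}y)$ is. Let $G$ be a compact group, $K$ a closed subgroup; $g$ on $G$ is bi-invariant with respect to $K$ if $g(kxl)=g(x)$ for $k,l\in K$. $(G,K)$ is a compact Gelfand pair if the continuous bi-$K$-invariant functions on $G$ form a commutative algebra under convolution $f*g(x)=\int_G f(y)g(y^{-1}x)\,d\omega_G(y)$, with $\omega_G$ Haar measure normalized by $\omega_G(G)=1$ ($\omega_K$ likewise on $K$). A spherical function is a continuous $\varphi:G\to\mathbb{C}$ with $\int_K\varphi(xky)\,d\omega_K(k)=\varphi(x)\varphi(y)$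 for all $x,y$ and $\varphi(e_G)=1$; $Z$ is the set of positive definite spherical functions. For $\varphi\in Z$, $\delta(\varphi)$ is the dimension of the span of $\{x\mapsto\varphi(g^{-1}x):g\in G\}$. $\mathcal P^\sharp_K(G,X^2)$ is the set of $f:G\times X^2\to\mathbb{C}$ such that $f$ is bi-invariant with respect to $K$ in the first variable, $f(\cdot,u,v)$ is continuous on $G$ for each $(u,v)\in X^2$, and the kernel $((x,u),(y,v))\mapsto f(x^{-1}y,u,v)$ on $G\times X$ is positive definite. *)

(* Defs.v *)
From Stdlib Require List.
From HB Require Import structures.
From mathcomp Require Import all_boot all_order all_algebra.
From mathcomp Require Import all_classical all_reals all_analysis.
From mathcomp.real_closed Require Import complex.
Set Implicit Arguments.
Unset Strict Implicit.
Unset Printing Implicit Defensive.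
Import Order.TTheory GRing.Theory Num.Theory.
Local Open Scope ring_scope.
Local Open Scope classical_set_scope.
Local Open Scope complex_scope.

Record compact_group (G : ptopologicalType) := CompactGroup {
  gmul : G -> G -> G;
  ginv : G -> G;
  gone : G;
  gmulA : associative gmul;
  gmul1g : left_id gone gmul;
  gmulVg : left_inverse gone ginv gmul;
  gmul_cont : continuous (fun p : G * G => gmul p.1 p.2);
  ginv_cont : continuous ginv;
  g_hausdorff : hausdorff_space G;
  g_compact : compact [set: G] }.

Definition Borel (G : ptopologicalType) := g_sigma_algebraType (@open G).

Section Defs.
Variables (R : realType) (G : ptopologicalType) (Gs : compact_group G).
Local Notation C := R[i].
Local Notation "x * y" := (gmul Gs x y) : group_scope.
Local Notation "x ^-1" := (ginv Gs x) : group_scope.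
Local Notation e := (gone Gs).

Definition is_haar (mu : probability (Borel G) R) : Prop :=
  forall (g : G) (A : set (Borel G)), measurable A ->
    mu ((gmul Gs g) @^-1` A) = mu A.

Definition closed_subgroup (K : set G) : Prop :=
  [/\ closed K, K e,
      (forall k l, K k -> K l -> K (gmul Gs k l)) &
      (forall k, K k -> K (ginv Gs k))].

(* normalized Haar measure omega_K on K, viewed (pushed forward) as a
   Borel probability on G concentrated on K and invariant under left
   translations by elements of K *)
Definition is_haar_on (K : set G) (nu : probability (Borel G) R) : Prop :=
  nu K = 1%E /\
  forall (k : G) (A : set (Borel G)), K k -> measurable A ->
    nu ((gmul Gs k) @^-1` A) = nu A.

Definition cint (mu : probability (Borel G) R) (h : G -> C) : C :=
  (Rintegral mu setT (fun x => @complex.Re R (h x)))%:C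
  + 'i * (Rintegral mu setT (fun x => @complex.Im R (h x)))%:C.

Definition contC (h : G -> C) : Prop :=
  forall (x : G) (eps : R), 0 < eps ->
    \forall y \near x, `|h y - h x| < eps%:C.

Definition bi_invariant (K : set G) (h : G -> C) : Prop :=
  forall k l x, K k -> K l -> h (gmul Gs (gmul Gs k x) l) = h x.

Definition conv (mu : probability (Borel G) R) (h1 h2 : G -> C) : G -> C :=
  fun x => cint mu (fun y => h1 y * h2 (gmul Gs (ginv Gs y) x)).

Definition gelfand_pair (mu : probability (Borel G) R) (K : set G) : Prop :=
  forall h1 h2 : G -> C, contC h1 -> contC h2 ->
    bi_invariant K h1 -> bi_invariant K h2 ->
    conv mu h1 h2 = conv mu h2 h1.

Definition spherical (nu : probability (Borel G) R) (phi : G -> C) : Prop :=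
  [/\ contC phi, phi e = 1 &
      forall x y, cint nu (fun k => phi (gmul Gs (gmul Gs x k) y))
                  = phi x * phi y].

Definition lin_indep (m : nat) (F : 'I_m -> G -> C) : Prop :=
  forall c : 'I_m -> C,
    (forall x, \sum_(i < m) c i * F i x = 0) -> forall i, c i = 0.

Definition ltransl (g : G) (phi : G -> C) : G -> C :=
  fun x => phi (gmul Gs (ginv Gs g) x).

(* span_dim phi n : the span of the left translates of phi has (finite)
   dimension n, i.e. n is the maximal number of linearly independent
   left translates of phi. *)
Definition span_dim (phi : G -> C) (n : nat) : Prop :=
  (exists g : 'I_n -> G, lin_indep (fun i => ltransl (g i) phi)) /\
  (forall (m : nat) (g : 'I_m -> G),
      lin_indep (fun i => ltransl (g i) phi) -> (m <= n)%N).

End Defs.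

Definition pd_kernel (R : realType) (Y : Type) (k : Y -> Y -> R[i]) : Prop :=
  forall (n : nat) (y : 'I_n -> Y) (c : 'I_n -> R[i]),
    0 <= \sum_(j < n) \sum_(l < n) k (y j) (y l) * c j * (c l)^*.

Section Defs2.
Variables (R : realType) (G : ptopologicalType) (Gs : compact_group G).
Local Notation C := R[i].

Definition pd_fun (phi : G -> C) : Prop :=
  contC phi /\ pd_kernel (fun x y : G => phi (gmul Gs (ginv Gs x) y)).

Definition Zset (nu : probability (Borel G) R) : set (G -> C) :=
  [set phi | pd_fun phi /\ spherical Gs nu phi].

Definition Psharp (K : set G) (X : Type) (f : G -> X -> X -> C) : Prop :=
  [/\ (forall u v, bi_invariant Gs K (fun x => f x u v)),
      (forall u v, contC (fun x => f x u v)) &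
      pd_kernel (fun p q : G * X => f (gmul Gs (ginv Gs p.1) q.1) p.2 q.2)].

End Defs2.

Definition fin_sub (I : Type) (A : set I) (l : seq I) : Prop :=
  List.NoDup l /\ forall i, List.In i l -> A i.

Definition has_sum (R : realType) (I : Type) (A : set I) (a : I -> R[i])
    (s : R[i]) : Prop :=
  forall eps : R, 0 < eps ->
    exists l0, fin_sub A l0 /\
      forall l, fin_sub A l -> (forall i, List.In i l0 -> List.In i l) ->
        `|\sum_(i <- l) a i - s| < eps%:C.

(* \sum_(i in A) a i < +oo for a family of nonnegative terms:
   finite partial sums are bounded *)
Definition finite_sum (R : realType) (I : Type) (A : set I) (a : I -> R[i])
    : Prop :=
  exists M : R, forall l, fin_sub A l -> \sum_(i <- l) a i <= M%:C.

Definition series_rep (R : realType) (G : ptopologicalType)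
    (Gs : compact_group G) (nu : probability (Borel G) R) (X : Type)
    (f : G -> X -> X -> R[i]) (B : (G -> R[i]) -> X -> X -> R[i]) : Prop :=
  [/\ (forall phi, Zset Gs nu phi -> pd_kernel (B phi)),
      (forall u, finite_sum (Zset Gs nu) (fun phi => B phi u u)) &
      (forall x u v,
          has_sum (Zset Gs nu) (fun phi => B phi u v * phi x) (f x u v))].

(* Main.v *)
(* Idea. For a continuous h with h~ = h, where h~(x) = conj h(x^-1), the
   convolution powers h^(2n), suitably normalized, converge uniformly to a
   nonzero idempotent p with h * h * p = lam p (power iteration). Bi-K-invariant
   self-adjoint idempotents q satisfy q(e) = |q|_2^2 >= 1, so below p there is a
   minimal one. By commutativity every bi-K-invariant function acts on a minimal
   q as a scalar, which forces q / q(e) to lie in Z. Hence a bi-K-invariant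
   continuous function orthogonal to Z vanishes. Bessel's inequality for positive
   definite functions makes sum_phi B(phi)(u,v) phi absolutely and uniformly
   convergent, and f(.,u,v) minus its sum is orthogonal to Z. No unimodularity
   and no regularity of the Haar measure is used: Fubini for continuous functions
   follows from finite quadrature rules. *)
Require Import Defs.
From Stdlib Require List Permutation.
From HB Require Import structures.
From mathcomp Require Import all_boot all_order all_algebra.
From mathcomp Require Import all_classical all_reals all_analysis.
From mathcomp.real_closed Require Import complex.
From mathcomp Require Import measurable_realfun ring lra zify.
Import Order.TTheory GRing.Theory Num.Theory.
Import numFieldNormedType.Exports.
Import ComplexField.Normc.
Local Open Scope ring_scope.
Local Open Scope classical_set_scope.
Local Open Scope complex_scope.
Set Implicit Arguments.
Unset Strict Implicit.
Unset Printing Implicit Defensive.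

(** * Complex-valued continuous functions and their integrals *)

(** No Hilbert space completion, Peter-Weyl theorem or spectral theorem for compact operators is
    invoked; everything stays inside continuous functions. This works because a value of [f * g] is
    the inner product of [f] with a translate of [star g], so that one extra convolution factor
    upgrades L2 estimates to uniform ones. A self-adjoint [h] may have extreme eigenvalues of both
    signs, so only its even powers are normalized and the iteration diagonalizes [h * h]; the action
    of [h] itself on a minimal idempotent has to be recovered by comparing two squares.

    The dimension enters through the identity delta(phi) |phi|_2^2 = 1. Since phi * phi = |phi|_2^2
    phi, the function phi(x^-1 y) / |phi|_2^2 is the reproducing kernel of the span of the
    translates of phi, and the trace of that kernel is the dimension.

    [Zset] need not be countable. Sums are therefore limits along finite subsets, and sequences of
    finite subsets are extracted only where a limit has to pass through an integral. *)

Section Modulus.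
Local Notation "z ^*" := (Num.conj z) : complex_scope.
Variable R : realType.
Implicit Types z w : R[i].

Lemma normcR z : `|z| = (normc z)%:C.
Proof. by []. Qed.

Lemma normc_ge0 z : 0 <= normc z.
Proof. by rewrite -ler0c -normcR. Qed.

Lemma normc_subC z w : normc (z - w) = normc (w - z).
Proof. by rewrite -opprB normcN. Qed.

Lemma normc_eq0 z : (normc z == 0) = (z == 0).
Proof.
by apply/eqP/eqP => [/eq0_normc//|->]; rewrite normc0.
Qed.

Lemma normc_conj z : normc z^* = normc z.
Proof. by case: z => a b /=; rewrite sqrrN. Qed.

Lemma normc_real (a : R) : normc a%:C = `|a|.
Proof. by rewrite /= expr0n addr0 sqrtr_sqr. Qed.

Lemma Re_le_normc z : `|complex.Re z| <= normc z.
Proof. by have := normc_ge_Re z; rewrite normcR lecR. Qed.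

Lemma Im_le_normc z : `|complex.Im z| <= normc z.
Proof.
by case: z => a b /=; rewrite -[X in X <= _]sqrtr_sqr ler_wsqrtr// lerDr sqr_ge0.
Qed.

Lemma normc_le_ReIm z : normc z <= `|complex.Re z| + `|complex.Im z|.
Proof.
case: z => a b /=; rewrite -[X in _ <= X]ger0_norm ?addr_ge0//.
rewrite -[X in _ <= X]sqrtr_sqr ler_wsqrtr//.
rewrite sqrrD !real_normK ?num_real// addrAC lerDl.
by rewrite mulrn_wge0// mulr_ge0.
Qed.

Lemma mulcJ z : z * z^* = (normc z ^+ 2)%:C.
Proof. by rewrite -sqr_normc normcR -rmorphXn. Qed.

Lemma conj_real (a : R) : (a%:C)^* = a%:C.
Proof. exact: conjc_real. Qed.

Lemma Re_addc z w : complex.Re (z + w) = complex.Re z + complex.Re w.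
Proof. by case: z => a b; case: w. Qed.

Lemma Im_addc z w : complex.Im (z + w) = complex.Im z + complex.Im w.
Proof. by case: z => a b; case: w. Qed.

Lemma Re_mulc z w :
  complex.Re (z * w) = complex.Re z * complex.Re w - complex.Im z * complex.Im w.
Proof. by case: z => a b; case: w. Qed.

Lemma Im_mulc z w :
  complex.Im (z * w) = complex.Re z * complex.Im w + complex.Im z * complex.Re w.
Proof. by case: z => a b; case: w. Qed.

Lemma Re_conjc z : complex.Re z^* = complex.Re z.
Proof. by case: z. Qed.

Lemma Im_conjc z : complex.Im z^* = - complex.Im z.
Proof. by case: z. Qed.

Lemma eq_ReIm z w : complex.Re z = complex.Re w -> complex.Im z = complex.Im w -> z = w.
Proof. by case: z => a b; case: w => c d /= -> ->. Qed.

Lemma Re_sum (I : Type) (r : seq I) (F : I -> R[i]) :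
  complex.Re (\sum_(i <- r) F i) = \sum_(i <- r) complex.Re (F i).
Proof. exact: (raddf_sum (@complex.Re R : Rcomplex R -> R)). Qed.

Lemma normc_sum (I : Type) (r : seq I) (F : I -> R[i]) :
  normc (\sum_(i <- r) F i) <= \sum_(i <- r) normc (F i).
Proof.
elim/big_ind2 : _ => [|z a w b za wb|//]; first by rewrite normc0.
by rewrite (le_trans (le_normcD _ _))// lerD.
Qed.

Lemma normc_le_eps z : (forall e : R, 0 < e -> normc z <= e) -> z = 0.
Proof.
move=> H; apply/eqP; rewrite -normc_eq0 eq_le normc_ge0 andbT.
by apply/ler_addgt0Pl => e e0; rewrite addr0 H.
Qed.

End Modulus.

Section Continuity.
Local Notation "z ^*" := (Num.conj z) : complex_scope.
Variable R : realType.

(** Splitting into real and imaginary parts gives access to the limit and measurability lemmas for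
    real functions; [contCP] links this form to [contC]. *)
Definition ctsC (U : topologicalType) (h : U -> R[i]) :=
  continuous (fun x => complex.Re (h x)) /\ continuous (fun x => complex.Im (h x)).

Lemma contCP (G : ptopologicalType) (h : G -> R[i]) : contC h <-> ctsC h.
Proof.
split=> [H|[Hr Hi] x e e0].
  split=> x; apply/cvgrPdist_lt => e e0; have := H x e e0;
    apply: filterS => y; rewrite normcR ltcR normc_subC;
    apply: le_lt_trans.
    by have := Re_le_normc (h x - h y); rewrite raddfB.
  by have := Im_le_normc (h x - h y); rewrite raddfB.
have e20 : 0 < e / 2 by rewrite divr_gt0.
move/cvgrPdist_lt: (Hr x) => /(_ _ e20) H1.
move/cvgrPdist_lt: (Hi x) => /(_ _ e20) H2.
near=> y; rewrite normcR ltcR normc_subC.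
apply: le_lt_trans (normc_le_ReIm _) _.
rewrite [ltRHS]splitr !raddfB ltrD//.
  by near: y; exact: H1.
by near: y; exact: H2.
Unshelve. all: by end_near. Qed.

Section Ops.
Variable U : topologicalType.
Implicit Types f g : U -> R[i].

Lemma ctsCE f : (forall x (e : R), 0 < e -> \forall y \near x, normc (f y - f x) <= e) ->
  ctsC f.
Proof.
move=> H; split=> x; apply/cvgrPdist_le => e e0; have := H x e e0;
    apply: filterS => y; rewrite normc_subC;
    apply: le_trans.
  by have := Re_le_normc (f x - f y); rewrite raddfB.
by have := Im_le_normc (f x - f y); rewrite raddfB.
Qed.

Lemma ctsC_near f x (e : R) : ctsC f -> 0 < e -> \forall y \near x, normc (f y - f x) <= e.
Proof.
move=> [Hr Hi] e0; have e20 : 0 < e / 2 by rewrite divr_gt0.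
move/cvgrPdist_lt: (Hr x) => /(_ _ e20) H1.
move/cvgrPdist_lt: (Hi x) => /(_ _ e20) H2.
near=> y; rewrite normc_subC.
apply: le_trans (normc_le_ReIm _) _.
rewrite [leRHS]splitr !raddfB lerD//; apply: ltW.
  by near: y; exact: H1.
by near: y; exact: H2.
Unshelve. all: by end_near. Qed.

Lemma ctsC_cst c : ctsC (fun _ : U => c).
Proof. by split=> x; exact: cvg_cst. Qed.

Lemma ctsCD f g : ctsC f -> ctsC g -> ctsC (fun x => f x + g x).
Proof.
move=> [fr fi] [gr gi]; split=> x; rewrite /continuous_at raddfD/=.
  under eq_fun do rewrite raddfD/=; apply: continuousD; [exact: fr|exact: gr].
under eq_fun do rewrite raddfD/=; apply: continuousD; [exact: fi|exact: gi].
Qed.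

Lemma ctsCM f g : ctsC f -> ctsC g -> ctsC (fun x => f x * g x).
Proof.
move=> [fr fi] [gr gi]; split=> x.
  rewrite /continuous_at Re_mulc; under eq_fun do rewrite Re_mulc.
  by apply: cvgB; apply: cvgM; [exact: fr|exact: gr|exact: fi|exact: gi].
rewrite /continuous_at Im_mulc; under eq_fun do rewrite Im_mulc.
by apply: cvgD; apply: cvgM; [exact: fr|exact: gi|exact: fi|exact: gr].
Qed.

Lemma ctsCJ f : ctsC f -> ctsC (fun x => (f x)^*).
Proof.
move=> [fr fi]; split=> x.
  by rewrite /continuous_at Re_conjc; under eq_fun do rewrite Re_conjc; exact: fr.
by rewrite /continuous_at Im_conjc; under eq_fun do rewrite Im_conjc; apply: cvgN; exact: fi.
Qed.

Lemma ctsC_sum (I : Type) (r : seq I) (F : I -> U -> R[i]) :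
  (forall i, ctsC (F i)) -> ctsC (fun x => \sum_(i <- r) F i x).
Proof.
move=> H; elim: r => [|i r IH].
  by under eq_fun do rewrite big_nil; exact: ctsC_cst.
by under eq_fun do rewrite big_cons; exact: ctsCD.
Qed.

Lemma ctsC_scale c f : ctsC f -> ctsC (fun x => c * f x).
Proof. by move=> cf; apply: ctsCM => //; exact: ctsC_cst. Qed.

Lemma ctsCB f g : ctsC f -> ctsC g -> ctsC (fun x => f x - g x).
Proof.
move=> cf cg; under eq_fun do rewrite -mulN1r.
by apply: ctsCD => //; exact: ctsC_scale.
Qed.

Lemma ctsC_bounded f : compact [set: U] -> ctsC f -> exists2 M, 0 < M & forall x, normc (f x) <= M.
Proof.
move=> /compact_near_coveringP cU cf.
have [] := cU nat \oo (fun n x => normc (f x) <= n%:R) _.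
  move=> x _.
  have n1 := ctsC_near x cf (@ltr01 R).
  exists ([set y | normc (f y - f x) <= 1],
          [set n | (Num.truncn (normc (f x) + 1)).+1 <= n]%N) => /=.
    by split=> //; exists (Num.truncn (normc (f x) + 1)).+1.
  move=> [y n]/= [H1 H2].
  rewrite -(subrK (f x) (f y)) (le_trans (le_normcD _ _))//.
  rewrite (le_trans (lerD H1 (lexx _)))// addrC.
  by rewrite (le_trans (ltW (truncnS_gt _)))// ler_nat.
move=> n _ H; exists (n%:R + 1) => [|x]; first by rewrite ltr_wpDl.
by rewrite (le_trans (H n _ x _))//= ?lerDl.
Qed.

End Ops.

Lemma ctsC_comp (U V : topologicalType) (f : V -> R[i]) (g : U -> V) :
  continuous g -> ctsC f -> ctsC (fun x => f (g x)).
Proof.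
move=> cg [fr fi]; split=> x.
  exact: (continuous_comp (cg x) (fr (g x))).
exact: (continuous_comp (cg x) (fi (g x))).
Qed.

End Continuity.

Section Integral.
Local Notation "z ^*" := (Num.conj z) : complex_scope.
Variables (R : realType) (G : ptopologicalType).
Implicit Types (m : probability (Borel G) R) (f g : G -> R[i]).

(** For a probability measure these functions are integrable. The class contains the continuous
    functions on a compact space and also the indicators that quadrature needs. *)
Definition bmeas f := [/\ measurable_fun [set: Borel G] (fun x => complex.Re (f x)),
  measurable_fun [set: Borel G] (fun x => complex.Im (f x)) &
  exists M, forall x, normc (f x) <= M].

Lemma continuous_borel (h : G -> R) :
  continuous h -> measurable_fun [set: Borel G] (h : Borel G -> R).
Proof.
move=> ch; apply: (measurability _ (RGenOpens.measurableE R)).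
move=> _ [_ [a [b ->]] <-]; rewrite setTI; apply: sub_sigma_algebra.
by move/continuousP : ch; apply; exact: interval_open.
Qed.

Lemma ctsC_bmeas f : compact [set: G] -> ctsC f -> bmeas f.
Proof.
move=> cG cf; split; [exact: continuous_borel cf.1|exact: continuous_borel cf.2|].
by have [M _ HM] := ctsC_bounded cG cf; exists M.
Qed.

Lemma bmeasD f g : bmeas f -> bmeas g -> bmeas (fun x => f x + g x).
Proof.
move=> [fr fi [M fM]] [gr gi [N gN]]; split.
- by under eq_fun do rewrite raddfD/=; exact: measurable_funD.
- by under eq_fun do rewrite raddfD/=; exact: measurable_funD.
- by exists (M + N) => x; rewrite (le_trans (le_normcD _ _))// lerD.
Qed.

Lemma bmeasZ c f : bmeas f -> bmeas (fun x => c * f x).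
Proof.
move=> [fr fi [M fM]]; split.
- under eq_fun do rewrite Re_mulc.
  by apply: measurable_funB; apply: measurable_funM => //; exact: measurable_cst.
- under eq_fun do rewrite Im_mulc.
  by apply: measurable_funD; apply: measurable_funM => //; exact: measurable_cst.
- by exists (normc c * M) => x; rewrite normcM ler_wpM2l// normc_ge0.
Qed.

Lemma bmeasB f g : bmeas f -> bmeas g -> bmeas (fun x => f x - g x).
Proof.
move=> bf bg; under eq_fun do rewrite -mulN1r.
by apply: bmeasD => //; exact: bmeasZ.
Qed.

Lemma bmeas_indic (A : set (Borel G)) : measurable A ->
  bmeas (fun x => (\1_A x : R)%:C).
Proof.
move=> mA; split; [exact: measurable_indic|exact: measurable_cst|].
by exists 1 => x; rewrite normc_real indicE; case: (x \in A); rewrite ?normr1 ?normr0.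
Qed.

Lemma bmeas_cst c : bmeas (fun=> c).
Proof. by split; [exact: measurable_cst|exact: measurable_cst|exists (normc c)]. Qed.

Lemma bmeas_sum (I : Type) (r : seq I) (F : I -> G -> R[i]) :
  (forall i, bmeas (F i)) -> bmeas (fun x => \sum_(i <- r) F i x).
Proof.
move=> H; elim: r => [|i r IH].
  by under eq_fun do rewrite big_nil; exact: bmeas_cst.
by under eq_fun do rewrite big_cons; exact: bmeasD.
Qed.

Lemma bounded_integrable m (h : Borel G -> R) M :
  measurable_fun setT h -> (forall x, `|h x| <= M) ->
  m.-integrable setT (EFin \o h).
Proof.
move=> mh hM; apply: measurable_bounded_integrable => //.
  by rewrite [ltLHS]probability_setT ltry.
exists M; split; first exact: num_real.
by move=> N MN x _ /=; rewrite (le_trans (hM x))// ltW.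
Qed.

Lemma bmeas_Re m f : bmeas f ->
  m.-integrable setT (EFin \o (fun x => complex.Re (f x))).
Proof.
move=> [fr _ [M fM]]; apply: bounded_integrable fr _ => x.
exact: le_trans (Re_le_normc _) (fM x).
Qed.

Lemma bmeas_Im m f : bmeas f ->
  m.-integrable setT (EFin \o (fun x => complex.Im (f x))).
Proof.
move=> [_ fi [M fM]]; apply: bounded_integrable fi _ => x.
exact: le_trans (Im_le_normc _) (fM x).
Qed.

Lemma cintE m f : cint m f =
  (Rintegral m setT (fun x => complex.Re (f x))) +i*
  (Rintegral m setT (fun x => complex.Im (f x))).
Proof.
apply: eq_ReIm; rewrite /cint raddfD/= ?(Re_mulc, Im_mulc)/=; simpl;
by rewrite ?(mul0r, mulr0, mul1r, addr0, add0r, subr0).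
Qed.

Lemma Re_cint m f :
  complex.Re (cint m f) = Rintegral m setT (fun x => complex.Re (f x)).
Proof. by rewrite cintE. Qed.

Lemma Im_cint m f :
  complex.Im (cint m f) = Rintegral m setT (fun x => complex.Im (f x)).
Proof. by rewrite cintE. Qed.

Lemma cint_ext m f g : f =1 g -> cint m f = cint m g.
Proof. by move=> /funext ->. Qed.

Lemma cintD m f g : bmeas f -> bmeas g ->
  cint m (fun x => f x + g x) = cint m f + cint m g.
Proof.
move=> bf bg; apply: eq_ReIm; rewrite (Re_cint, Im_cint) [RHS](Re_addc, Im_addc) !(Re_cint, Im_cint).
  rewrite -RintegralD//; try exact: bmeas_Re.
  by apply: eq_Rintegral => x _; rewrite (Re_addc, Im_addc).
rewrite -RintegralD//; try exact: bmeas_Im.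
by apply: eq_Rintegral => x _; rewrite (Re_addc, Im_addc).
Qed.

Lemma integrable_scale m (h : Borel G -> R) a : m.-integrable setT (EFin \o h) ->
  m.-integrable setT (EFin \o (fun x => a * h x)).
Proof.
move=> hi; rewrite (_ : _ \o _ = (fun x => a%:E * (EFin \o h) x)%E); last exact/funext.
exact: integrableZl.
Qed.

Lemma cintZ m c f : bmeas f -> cint m (fun x => c * f x) = c * cint m f.
Proof.
move=> bf; have fr := bmeas_Re m bf; have fi := bmeas_Im m bf.
apply: eq_ReIm; rewrite ?(Re_mulc, Im_mulc) ?(Re_cint, Im_cint).
  rewrite -!RintegralZl// -RintegralB//; try exact: integrable_scale.
  by apply: eq_Rintegral => x _; rewrite Re_mulc.
rewrite -!RintegralZl// -RintegralD//; try exact: integrable_scale.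
by apply: eq_Rintegral => x _; rewrite Im_mulc.
Qed.

Lemma cintB m f g : bmeas f -> bmeas g ->
  cint m (fun x => f x - g x) = cint m f - cint m g.
Proof.
move=> bf bg; under cint_ext do rewrite -mulN1r.
by rewrite cintD ?cintZ ?mulN1r//; exact: bmeasZ.
Qed.

Lemma cint_cst m c : cint m (fun=> c) = c.
Proof.
by apply: eq_ReIm; rewrite ?(Re_cint, Im_cint) Rintegral_cst//
  [X in fine X]probability_setT mulr1.
Qed.

Lemma cint_sum m (I : Type) (r : seq I) (F : I -> G -> R[i]) :
  (forall i, bmeas (F i)) ->
  cint m (fun x => \sum_(i <- r) F i x) = \sum_(i <- r) cint m (F i).
Proof.
move=> H; elim: r => [|i r IH].
  by under cint_ext do rewrite big_nil; rewrite cint_cst big_nil.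
under cint_ext do rewrite big_cons.
by rewrite cintD ?IH ?big_cons//; exact: bmeas_sum.
Qed.

Lemma cintJ m f : bmeas f -> cint m (fun x => (f x)^*) = (cint m f)^*.
Proof.
move=> bf; apply: eq_ReIm; rewrite ?(Re_conjc, Im_conjc) ?(Re_cint, Im_cint).
  by apply: eq_Rintegral => x _; rewrite Re_conjc.
rewrite -mulN1r -RintegralZl//; last exact: bmeas_Im.
by apply: eq_Rintegral => x _; rewrite Im_conjc mulN1r.
Qed.

Lemma cint_ge0 m f : (forall x, 0 <= f x) -> 0 <= cint m f.
Proof.
move=> f0; rewrite lecE Re_cint Im_cint; apply/andP; split.
  apply/eqP; under eq_Rintegral do rewrite ger0_Im//.
  by rewrite Rintegral_cst// mul0r.
by apply: Rintegral_ge0 => x _; have := f0 x; rewrite lecE => /andP[].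
Qed.

(** The factor 2 comes from bounding real and imaginary parts separately. It is harmless wherever
    the bound is an arbitrary epsilon; sharp inequalities go through [cint_ge0] instead. *)
Lemma normc_cint m f M : bmeas f -> (forall x, normc (f x) <= M) ->
  normc (cint m f) <= 2 * M.
Proof.
move=> bf fM; have fr := bmeas_Re m bf; have fi := bmeas_Im m bf.
have aux (h : Borel G -> R) : m.-integrable setT (EFin \o h) ->
    (forall x, `|h x| <= M) -> `|Rintegral m setT h| <= M.
  move=> hi hM; apply: le_trans (le_normr_Rintegral _ hi) _ => //.
  have -> : M = Rintegral m setT (fun=> M).
    by rewrite Rintegral_cst// [X in fine X]probability_setT mulr1.
  apply: le_Rintegral => //; first exact: integrable_norm hi.
  exact: finite_measure_integrable_cst.
apply: le_trans (normc_le_ReIm _) _; rewrite mulr_natl mulr2n lerD//.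
  by rewrite Re_cint aux// => x; exact: le_trans (Re_le_normc _) (fM x).
by rewrite Im_cint aux// => x; exact: le_trans (Im_le_normc _) (fM x).
Qed.

Lemma cint_indic m (A : set (Borel G)) : measurable A ->
  cint m (fun x => (\1_A x : R)%:C) = (fine (m A))%:C.
Proof.
move=> mA; apply: eq_ReIm; rewrite ?(Re_cint, Im_cint)/=.
  by rewrite /Rintegral integral_indic// setIT.
by rewrite Rintegral_cst// mul0r.
Qed.

Lemma cint_pushforward m (s : G -> G) f : continuous s ->
  (forall A : set (Borel G), measurable A -> m (s @^-1` A) = m A) ->
  bmeas f -> cint m (fun x => f (s x)) = cint m f.
Proof.
move=> cs ms bf.
have mes : measurable_fun [set: Borel G] (s : Borel G -> Borel G).
  apply: (@measurability _ _ (Borel G) (Borel G) _ _ (@open G)) => //.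
  move=> _ [A oA <-]; rewrite setTI; apply: sub_sigma_algebra.
  by move/continuousP : cs; apply.
have aux (h : Borel G -> R) : measurable_fun setT h ->
    (exists M, forall x, `|h x| <= M) ->
    Rintegral m setT (h \o s) = Rintegral m setT h.
  move=> mh [M hM]; rewrite /Rintegral; congr fine.
  transitivity (\int[pushforward m (s : Borel G -> Borel G)]_x (EFin \o h) x)%E.
    rewrite integral_pushforward//; first exact/measurable_EFinP.
    have -> : (EFin \o h) \o s = EFin \o (h \o s) by [].
    apply: (@bounded_integrable m _ M) => //=.
    exact: measurableT_comp.
  by apply: eq_measure_integral => /= A mA _; rewrite -[RHS]ms.
case: bf => fr fi [M fM]; apply: eq_ReIm; rewrite ?(Re_cint, Im_cint).
  apply: (aux (fun x => complex.Re (f x))) => //.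
  by exists M => x; exact: le_trans (Re_le_normc _) (fM x).
apply: (aux (fun x => complex.Im (f x))) => //.
by exists M => x; exact: le_trans (Im_le_normc _) (fM x).
Qed.

(** Serves the averages over a subgroup: the measure on [K] lives on all of the group, but
    identities hold only for points of [K]. *)
Lemma eq_cint_on m (K : set (Borel G)) f g : measurable K -> m K = 1%E ->
  bmeas f -> bmeas g -> (forall x, K x -> f x = g x) -> cint m f = cint m g.
Proof.
move=> mK mK1 bf bg fg.
have m0 : m (~` K) = 0%E.
  by rewrite probability_setC// mK1 subee.
have aux (h : Borel G -> R) : m.-integrable setT (EFin \o h) ->
    Rintegral m setT h = Rintegral m K h.
  move=> hi; rewrite /Rintegral (negligible_integral _ _ hi m0)//; last exact: measurableC.
  by rewrite setDE setCK setTI.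
apply: eq_ReIm; rewrite ?(Re_cint, Im_cint) aux.
- rewrite [RHS]aux; last exact: bmeas_Re.
  by apply: eq_Rintegral => x; rewrite inE => /fg ->.
- exact: bmeas_Re.
- rewrite [RHS]aux; last exact: bmeas_Im.
  by apply: eq_Rintegral => x; rewrite inE => /fg ->.
- exact: bmeas_Im.
Qed.

End Integral.

(** * Quadrature and Fubini on a compact space *)

Section Quadrature.
Variables (R : realType) (G : ptopologicalType).
Hypothesis cG : compact [set: G].
Implicit Types (m : probability (Borel G) R) (f g : G -> R[i]) (E : G -> G -> Prop).

Lemma finite_cover E : (forall x, \forall y \near x, E x y) ->
  exists s : seq G, forall y, exists2 p, p \in s & (interior (E p)) y.
Proof.
move=> nE; move: cG; rewrite compact_cover => /(_ G setT (fun x => (E x)^°)).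
case=> [x _|x _|D _ cov]; first exact: open_interior.
  by exists x => //; exact: nE.
by exists (finmap.enum_fset D) => y; have [p /= pD py] := cov y I; exists p.
Qed.

(** Sending each point to the first open set that contains it makes a finite open cover into a
    measurable partition. *)
Lemma measurable_find (s : seq G) (A : G -> set G) i : (forall p, open (A p)) ->
  measurable ([set x | find (fun p => `[< A p x >]) s = i] : set (Borel G)).
Proof.
move=> oA; elim: s i => [|p s IH] [|i] /=.
- by rewrite (_ : [set _ | _] = setT)//; apply/seteqP.
- by rewrite (_ : [set _ | _] = set0)//; apply/seteqP; split.
- rewrite (_ : [set _ | _] = A p); first exact: sub_sigma_algebra.
  by apply/seteqP; split=> x /=; case: asboolP.
- rewrite (_ : [set _ | _] = ~` (A p) `&`
    [set x | find (fun p => `[< A p x >]) s = i]); last first.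
    apply/seteqP; split=> x /=; case: asboolP => //.
      by move=> nAx [].
    by move=> Ax [].
    by move=> _ [_ ->].
  by apply: measurableI => //; apply: measurableC; exact: sub_sigma_algebra.
Qed.

(* E x y reads "y is close to x": the nodes and weights come from a finite
   measurable partition into sets of points E-close to a common node, and serve
   all functions g with E-small oscillation at once. *)
Lemma quadrature m E : (forall x, \forall y \near x, E x y) ->
  exists n (w : 'I_n -> R) (p : 'I_n -> G),
  [/\ forall i, 0 <= w i, \sum_i w i = 1 &
    forall g (eps : R), bmeas g ->
      (forall x y, E x y -> normc (g y - g x) <= eps) ->
      normc (cint m g - \sum_i (w i)%:C * g (p i)) <= 2 * eps].
Proof.
move=> /finite_cover[s cov].
pose idx x := find (fun p => `[< (E p)^° x >]) s.
have idx_lt x : (idx x < size s)%N.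
  rewrite -has_find; apply/hasP; have [p ps Ep] := cov x.
  by exists p => //; exact/asboolP.
pose A (i : 'I_(size s)) : set (Borel G) := [set x | idx x = i].
have mA i : measurable (A i) by apply: measurable_find => p; exact: open_interior.
pose p (i : 'I_(size s)) := nth point s i.
have Ep x : E (p (Ordinal (idx_lt x))) x.
  have : has (fun p => `[< (E p)^° x >]) s by rewrite has_find idx_lt.
  by move/(nth_find point)/asboolP; exact: interior_subset.
have sumA x (c : 'I_(size s) -> R[i]) :
    \sum_i c i * (\1_(A i) x : R)%:C = c (Ordinal (idx_lt x)).
  rewrite (bigD1 (Ordinal (idx_lt x)))//= big1 => [|i ix].
    by rewrite addr0 indicE mem_set// mulr1.
  rewrite indicE memNset ?mulr0// => xi; case/eqP: ix; apply: val_inj.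
  exact: esym xi.
have bA c : bmeas (fun x => \sum_i c i * (\1_(A i) x : R)%:C).
  by apply: bmeas_sum => i; apply: bmeasZ; exact: bmeas_indic.
have IA c : cint m (fun x => \sum_i c i * (\1_(A i) x : R)%:C) =
    \sum_i c i * (fine (m (A i)))%:C.
  rewrite cint_sum => [|i]; last by apply: bmeasZ; exact: bmeas_indic.
  by apply: eq_bigr => i _; rewrite cintZ ?cint_indic//; exact: bmeas_indic.
exists (size s), (fun i => fine (m (A i))), p; split => [i||g eps bg gE].
- by rewrite fine_ge0.
- apply: complexI; rewrite rmorph_sum rmorph1/= -[RHS](cint_cst m 1).
  transitivity (\sum_i 1 * (fine (m (A i)))%:C : R[i]).
    by apply: eq_bigr => i _; rewrite mul1r.
  by rewrite -IA; apply: cint_ext => x; rewrite sumA.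
- under eq_bigr do rewrite mulrC.
  rewrite -IA -cintB//; apply: normc_cint => [|x]; first exact: bmeasB.
  by rewrite sumA gE.
Qed.

(** Compactness of the first factor makes continuity in the second variable uniform in the first. *)
Lemma tube (F : G * G -> R[i]) y0 (eps : R) : ctsC F -> 0 < eps ->
  \forall y \near y0, forall x, normc (F (x, y) - F (x, y0)) <= eps.
Proof.
move=> cF e0; move/compact_near_coveringP : cG => nc.
have H x : [set: G] x -> \forall x' \near x & y \near y0,
    normc (F (x', y) - F (x', y0)) <= eps.
  move=> _; have e20 : 0 < eps / 2 by rewrite divr_gt0.
  have [[A B]/= [nA nB] AB] := ctsC_near (x, y0) cF e20.
  exists (A, B) => //= -[x' y]/= [Ax By].
  rewrite -(subrK (F (x, y0)) (F (x', y))) -addrA.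
  apply: le_trans (le_normcD _ _) _; rewrite [leRHS]splitr lerD//.
    exact: (AB (x', y)).
  by rewrite normc_subC; apply: (AB (x', y0)); split => //; exact: nbhs_singleton.
have := nc G (nbhs y0) (fun y x => normc (F (x, y) - F (x, y0)) <= eps)
  (nbhs_filter y0) H.
move=> near_y0; apply: filterS near_y0 => y Hy x; exact: Hy.
Qed.

Lemma swap_cts : continuous (fun z : G * G => (z.2, z.1)).
Proof. by move=> z; apply: cvg_pair; [exact: cvg_snd|exact: cvg_fst]. Qed.

Lemma pair_cts (x : G) : continuous (fun y : G => (x, y)).
Proof. by move=> y; apply: cvg_pair; [exact: cvg_cst|exact: cvg_id]. Qed.

Lemma cint_bound m f g (eps : R) : ctsC f -> ctsC g ->
  (forall x, normc (f x - g x) <= eps) -> normc (cint m f - cint m g) <= 2 * eps.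
Proof.
move=> cf cg fg; rewrite -cintB; try exact: ctsC_bmeas.
by apply: normc_cint => //; apply: ctsC_bmeas => //; exact: ctsCB.
Qed.

Lemma ctsC_cint m (F : G * G -> R[i]) : ctsC F ->
  ctsC (fun y => cint m (fun x => F (x, y))).
Proof.
move=> cF; have cFy y : ctsC (fun x => F (x, y)).
  have := ctsC_comp (@pair_cts y) (ctsC_comp swap_cts cF); exact.
apply: ctsCE => y e e0; have e20 : 0 < e / 2 by rewrite divr_gt0.
have := tube y cF e20; apply: filterS => y' H.
by rewrite (_ : e = 2 * (e / 2)); [exact: cint_bound|rewrite mulrC divfK].
Qed.

(** A quadrature rule in [x] that is good for all [y] at once replaces one integral by a finite sum,
    and finite sums commute with integrals. *)
Lemma fubini_cts m1 m2 (F : G * G -> R[i]) : ctsC F ->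
  cint m2 (fun y => cint m1 (fun x => F (x, y))) =
  cint m1 (fun x => cint m2 (fun y => F (x, y))).
Proof.
move=> cF; have cFs := ctsC_comp swap_cts cF.
have cFy y : ctsC (fun x => F (x, y)) by have := ctsC_comp (@pair_cts y) cFs; exact.
have cFx x : ctsC (fun y => F (x, y)) by exact: ctsC_comp (@pair_cts x) cF.
have c1 := ctsC_cint m1 cF; have c2 := ctsC_cint m2 cFs.
apply/eqP; rewrite -subr_eq0; apply/eqP; apply: normc_le_eps => e e0.
have e80 : 0 < e / 8 by rewrite divr_gt0.
have [|n [w [p [w0 w1 Q]]]] :=
  @quadrature m1 (fun x x' => forall y, normc (F (x', y) - F (x, y)) <= e / 8).
  by move=> x; exact: (tube x cFs e80).
pose S := \sum_i (w i)%:C * cint m2 (fun y => F (p i, y)).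
rewrite -(subrK S (cint m2 _)) -addrA.
apply: le_trans (le_normcD _ _) _.
(* In each half one factor 2 is the quadrature error and the other is lost by [cint_bound] in the
   remaining integral. *)
have -> : e = 2 * (2 * (e / 8)) + 2 * (2 * (e / 8)) by field.
apply: lerD.
  rewrite /S -(@eq_bigr _ _ _ _ _ _ 
    (fun i => cint m2 (fun y => (w i)%:C * F (p i, y)))); last first.
    by move=> i _; rewrite cintZ//; exact: ctsC_bmeas.
  have cS i : ctsC (fun y => (w i)%:C * F (p i, y)) by exact: ctsC_scale.
  rewrite -cint_sum; last by move=> i; exact: ctsC_bmeas.
  apply: cint_bound => //; first exact: ctsC_sum.
  move=> y; apply: Q; first exact: ctsC_bmeas.
  by move=> x x' H; exact: H.
rewrite normc_subC; apply: Q; first exact: ctsC_bmeas.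
by move=> x x' H; exact: cint_bound.
Qed.

End Quadrature.

(** * Group identities and continuity of the group operations *)

Section Group.
Variables (G : ptopologicalType) (Gs : compact_group G).
Local Notation "x *g y" := (gmul Gs x y) (at level 40, left associativity).
Local Notation inv := (ginv Gs).
Local Notation e := (gone Gs).

Lemma gmulKg x y : inv x *g (x *g y) = y.
Proof. by rewrite gmulA gmulVg gmul1g. Qed.

Lemma gmulgV x : x *g inv x = e.
Proof.
by rewrite -[LHS](gmul1g Gs) -[X in X *g _](gmulVg Gs (inv x)) -gmulA [X in _ *g X]gmulKg gmulVg.
Qed.

Lemma gmulg1 x : x *g e = x.
Proof. by rewrite -(gmulVg Gs x) gmulA gmulgV gmul1g. Qed.

Lemma gmulKVg x y : x *g (inv x *g y) = y.
Proof. by rewrite gmulA gmulgV gmul1g. Qed.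

Lemma ginvK x : inv (inv x) = x.
Proof. by rewrite -[LHS]gmulg1 -(gmulVg Gs x) gmulKg. Qed.

Lemma ginvM x y : inv (x *g y) = inv y *g inv x.
Proof.
by rewrite -[RHS](gmulKg (x *g y)) -gmulA gmulKVg gmulgV gmulg1.
Qed.

Lemma ginv1 : inv e = e.
Proof. by rewrite -[LHS]gmulg1 gmulVg. Qed.

Lemma mul_cts (U : topologicalType) (s t : U -> G) :
  continuous s -> continuous t -> continuous (fun u => s u *g t u).
Proof.
move=> cs ct u.
apply: (@continuous_comp _ _ _ (fun u => (s u, t u)) (fun p => p.1 *g p.2)).
  by apply: cvg_pair; [exact: cs|exact: ct].
exact: gmul_cont.
Qed.

Lemma inv_cts (U : topologicalType) (s : U -> G) :
  continuous s -> continuous (fun u => inv (s u)).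
Proof. by move=> cs u; apply: continuous_comp; [exact: cs|exact: ginv_cont]. Qed.

Lemma id_cts (U : topologicalType) : continuous (fun u : U => u).
Proof. by move=> u; exact: cvg_id. Qed.

Lemma cst_cts (U : topologicalType) (x : G) : continuous (fun _ : U => x).
Proof. by move=> u; exact: cvg_cst. Qed.

Lemma fst_cts (U V : topologicalType) : continuous (fun z : U * V => z.1).
Proof. by move=> z; exact: cvg_fst. Qed.

Lemma snd_cts (U V : topologicalType) : continuous (fun z : U * V => z.2).
Proof. by move=> z; exact: cvg_snd. Qed.

End Group.

(** * Convolution on a compact group *)

Section Convolution.
Local Notation "z ^*" := (Num.conj z) : complex_scope.
Variables (R : realType) (G : ptopologicalType) (Gs : compact_group G).
Variables (mu : probability (Borel G) R) (hmu : is_haar Gs mu).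
Local Notation "x *g y" := (gmul Gs x y) (at level 40, left associativity).
Local Notation inv := (ginv Gs).
Local Notation e := (gone Gs).
Local Notation "f *c g" := (Defs.conv Gs mu f g) (at level 40, left associativity).
Local Notation I := (cint mu).
Implicit Types (f g h : G -> R[i]).

Let cG : compact [set: G] := g_compact Gs.

Definition star f : G -> R[i] := fun x => (f (inv x))^*.

Definition ip f g : R[i] := I (fun x => f x * (g x)^*).

Definition nsq f : R := complex.Re (ip f f).

Lemma group_bmeas f : ctsC f -> bmeas f. Proof. exact: ctsC_bmeas. Qed.

Lemma ctsC_star f : ctsC f -> ctsC (star f).
Proof.
move=> cf; apply: ctsCJ; apply: (ctsC_comp _ cf).
by apply: inv_cts; exact: id_cts.
Qed.

Lemma ctsC_transl f a : ctsC f -> ctsC (fun y => f (a *g y)).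
Proof.
move=> cf; apply: (ctsC_comp _ cf).
by apply: mul_cts; [exact: cst_cts|exact: id_cts].
Qed.

Lemma haar_transl f a : ctsC f -> I (fun y => f (a *g y)) = I f.
Proof.
move=> cf; apply: cint_pushforward (group_bmeas cf) => [|A mA]; last exact: hmu.
by apply: mul_cts; [exact: cst_cts|exact: id_cts].
Qed.

Lemma conv_integrand_cts f g : ctsC f -> ctsC g ->
  ctsC (fun z : G * G => f z.1 * g (inv z.1 *g z.2)).
Proof.
move=> cf cg; apply: ctsCM; first exact: ctsC_comp (@fst_cts _ _) cf.
apply: (ctsC_comp _ cg); apply: mul_cts; last exact: snd_cts.
by apply: inv_cts; exact: fst_cts.
Qed.

Lemma conv_section_cts f g x : ctsC f -> ctsC g ->
  ctsC (fun y => f y * g (inv y *g x)).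
Proof.
move=> cf cg; apply: ctsCM => //.
apply: (ctsC_comp _ cg); apply: mul_cts; last exact: cst_cts.
by apply: inv_cts; exact: id_cts.
Qed.

Lemma ctsC_conv f g : ctsC f -> ctsC g -> ctsC (f *c g).
Proof. by move=> cf cg; exact: (ctsC_cint cG mu (conv_integrand_cts cf cg)). Qed.

Lemma convfA f g h : ctsC f -> ctsC g -> ctsC h -> (f *c g) *c h = f *c (g *c h).
Proof.
move=> cf cg ch; apply/funext => x; rewrite /Defs.conv.
transitivity (I (fun y => I (fun z => f z * g (inv z *g y) * h (inv y *g x)))).
  apply: cint_ext => y; rewrite mulrC -cintZ; last exact/group_bmeas/conv_section_cts.
  by apply: cint_ext => z; rewrite mulrC.
have cF : ctsC (fun z : G * G => f z.1 * g (inv z.1 *g z.2) * h (inv z.2 *g x)).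
  apply: ctsCM; first exact: conv_integrand_cts.
  apply: (ctsC_comp _ ch); apply: mul_cts; last exact: cst_cts.
  by apply: inv_cts; exact: snd_cts.
rewrite (fubini_cts cG mu mu cF); apply: cint_ext => z /=.
rewrite -cintZ; last exact/group_bmeas/conv_section_cts.
rewrite -(haar_transl (f := fun y => f z * g (inv z *g y) * h (inv y *g x)) z); last first.
  exact: (ctsC_comp (@pair_cts _ z) cF).
by apply: cint_ext => y; rewrite gmulKg ginvM !gmulA mulrA.
Qed.

Lemma starK f : star (star f) = f.
Proof. by apply/funext => x; rewrite /star conjCK ginvK. Qed.

(** Translating the integration variable of the right side by [x] produces the conjugate of the
    integrand on the left. *)
Lemma star_conv f g : ctsC f -> ctsC g -> star (f *c g) = star g *c star f.
Proof.
move=> cf cg; apply/funext => x; rewrite /star /Defs.conv.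
rewrite -cintJ; last exact/group_bmeas/conv_section_cts.
rewrite -[RHS](haar_transl (f := fun y => star g y * star f (inv y *g x)) x); last first.
  by apply: (@conv_section_cts (star g) (star f) x); exact: ctsC_star.
apply: cint_ext => y.
by rewrite rmorphM/= mulrC /star !ginvM !ginvK gmulA gmulVg gmul1g.
Qed.

Lemma convDl f g h : ctsC f -> ctsC g -> ctsC h ->
  (fun x => f x + g x) *c h = (fun x => (f *c h) x + (g *c h) x).
Proof.
move=> cf cg ch; apply/funext => x; rewrite /Defs.conv -cintD; try exact/group_bmeas/conv_section_cts.
by apply: cint_ext => y; rewrite mulrDl.
Qed.

Lemma convZl c f h : ctsC f -> ctsC h ->
  (fun x => c * f x) *c h = (fun x => c * (f *c h) x).
Proof.
move=> cf ch; apply/funext => x; rewrite /Defs.conv -cintZ; try exact/group_bmeas/conv_section_cts.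
by apply: cint_ext => y; rewrite mulrA.
Qed.

Lemma convDr f g h : ctsC f -> ctsC g -> ctsC h ->
  h *c (fun x => f x + g x) = (fun x => (h *c f) x + (h *c g) x).
Proof.
move=> cf cg ch; apply/funext => x; rewrite /Defs.conv -cintD; try exact/group_bmeas/conv_section_cts.
by apply: cint_ext => y; rewrite mulrDr.
Qed.

Lemma convZr c f h : ctsC f -> ctsC h ->
  h *c (fun x => c * f x) = (fun x => c * (h *c f) x).
Proof.
move=> cf ch; apply/funext => x; rewrite /Defs.conv -cintZ; try exact/group_bmeas/conv_section_cts.
by apply: cint_ext => y; rewrite mulrCA.
Qed.

Lemma subfE f g : (fun x => f x - g x) = (fun x => f x + (fun y => -1 * g y) x).
Proof. by apply/funext => x; rewrite mulN1r. Qed.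

Lemma convBl f g h : ctsC f -> ctsC g -> ctsC h ->
  (fun x => f x - g x) *c h = (fun x => (f *c h) x - (g *c h) x).
Proof.
move=> cf cg ch; rewrite !subfE convDl ?convZl//; exact: ctsC_scale.
Qed.

Lemma convBr f g h : ctsC f -> ctsC g -> ctsC h ->
  h *c (fun x => f x - g x) = (fun x => (h *c f) x - (h *c g) x).
Proof.
move=> cf cg ch; rewrite !subfE convDr ?convZr//; exact: ctsC_scale.
Qed.

Lemma star_add f g : star (fun x => f x + g x) = (fun x => star f x + star g x).
Proof. by apply/funext => x; rewrite /star rmorphD. Qed.

Lemma star_sub f g : star (fun x => f x - g x) = (fun x => star f x - star g x).
Proof. by apply/funext => x; rewrite /star rmorphB. Qed.

Lemma star_scale c f : star (fun x => c * f x) = (fun x => c^* * star f x).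
Proof. by apply/funext => x; rewrite /star rmorphM. Qed.

Lemma ip_cts f g : ctsC f -> ctsC g -> ctsC (fun x => f x * (g x)^*).
Proof. by move=> cf cg; apply: ctsCM => //; exact: ctsCJ. Qed.

Lemma ip_conv f g : ip f g = (f *c star g) e.
Proof. by apply: cint_ext => x; rewrite /star gmulg1 ginvK. Qed.

Lemma conv_ip f g x : (f *c g) x = ip f (fun y => star g (inv x *g y)).
Proof.
by rewrite /ip; apply: cint_ext => y; rewrite /star conjCK ginvM ginvK.
Qed.

Lemma ipJ f g : ctsC f -> ctsC g -> (ip f g)^* = ip g f.
Proof.
move=> cf cg; rewrite -cintJ; last exact/group_bmeas/ip_cts.
by apply: cint_ext => x; rewrite rmorphM/= conjCK mulrC.
Qed.

Lemma ipDl f g h : ctsC f -> ctsC g -> ctsC h ->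
  ip (fun x => f x + g x) h = ip f h + ip g h.
Proof.
move=> cf cg ch; rewrite /ip -cintD; try exact/group_bmeas/ip_cts.
by apply: cint_ext => x; rewrite mulrDl.
Qed.

Lemma ipZl c f h : ctsC f -> ctsC h -> ip (fun x => c * f x) h = c * ip f h.
Proof.
move=> cf ch; rewrite /ip -cintZ; try exact/group_bmeas/ip_cts.
by apply: cint_ext => x; rewrite mulrA.
Qed.

Lemma ipBl f g h : ctsC f -> ctsC g -> ctsC h ->
  ip (fun x => f x - g x) h = ip f h - ip g h.
Proof.
by move=> cf cg ch; rewrite subfE ipDl ?ipZl ?mulN1r//; exact: ctsC_scale.
Qed.

Lemma ipZr c f h : ctsC f -> ctsC h -> ip h (fun x => c * f x) = c^* * ip h f.
Proof.
move=> cf ch; rewrite /ip -cintZ; try exact/group_bmeas/ip_cts.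
by apply: cint_ext => x; rewrite rmorphM/= mulrCA.
Qed.

Lemma ipBr f g h : ctsC f -> ctsC g -> ctsC h ->
  ip h (fun x => f x - g x) = ip h f - ip h g.
Proof.
move=> cf cg ch; rewrite /ip -cintB; try exact/group_bmeas/ip_cts.
by apply: cint_ext => x; rewrite rmorphB/= mulrBr.
Qed.

Lemma ip_suml (T : Type) (r : seq T) (F : T -> G -> R[i]) h :
  (forall i, ctsC (F i)) -> ctsC h ->
  ip (fun x => \sum_(i <- r) F i x) h = \sum_(i <- r) ip (F i) h.
Proof.
move=> cF ch; rewrite /ip -cint_sum; last by move=> i; exact/group_bmeas/ip_cts.
by apply: cint_ext => x; rewrite mulr_suml.
Qed.

Lemma ip_ge0 f : 0 <= ip f f.
Proof. by apply: cint_ge0 => x; rewrite mul_conjC_ge0. Qed.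

Lemma ip_nsq f : ip f f = (nsq f)%:C.
Proof. by rewrite RRe_real// ger0_real// ip_ge0. Qed.

Lemma nsq_ge0 f : 0 <= nsq f.
Proof. by rewrite -ler0c -ip_nsq ip_ge0. Qed.

Lemma nsq_transl f a : ctsC f -> nsq (fun y => f (a *g y)) = nsq f.
Proof.
by move=> cf; rewrite /nsq /ip (haar_transl (f := fun y => f y * (f y)^*) a (ip_cts cf cf)).
Qed.

(* Finitely many translates of the open set where |f| is large cover G. *)
Lemma ip_eq0 f : ctsC f -> ip f f = 0 -> forall x, f x = 0.
Proof.
move=> cf f0 x0; apply/eqP; rewrite -normc_eq0 eq_le normc_ge0 andbT leNgt.
apply/negP => d0; have d20 : 0 < normc (f x0) / 2 by rewrite divr_gt0.
set d := normc (f x0) / 2 in d20.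
pose E a y := normc (f (x0 *g (inv a *g y)) - f x0) <= d.
have nE a : \forall y \near a, E a y.
  have cy : ctsC (fun y => f (x0 *g (inv a *g y))).
    exact: (@ctsC_transl (fun y => f (x0 *g y)) (inv a) (@ctsC_transl f x0 cf)).
  by have := ctsC_near a cy d20; rewrite gmulVg gmulg1.
have [s cov] := finite_cover cG nE.
pose F y := \sum_(p <- s) f (x0 *g inv p *g y) * (f (x0 *g inv p *g y))^*.
have cF p : ctsC (fun y => f (x0 *g inv p *g y) * (f (x0 *g inv p *g y))^*).
  by apply: (@ctsC_transl (fun y => f y * (f y)^*)); exact: ip_cts.
have F0 : I F = 0.
  rewrite cint_sum => [|p]; last exact/group_bmeas/cF.
  rewrite big1// => p _.
  by rewrite (haar_transl (f := fun y => f y * (f y)^*) (x0 *g inv p) (ip_cts cf cf)).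
have Fd y : 0 <= F y - (d ^+ 2)%:C.
  have [p ps Ep] := cov y.
  rewrite /F (big_rem p)//= -addrA addrC -addrA addr_ge0 ?sumr_ge0//.
    by move=> i _; rewrite mul_conjC_ge0.
  rewrite addrC mulcJ subr_ge0 lecR ler_sqr ?nnegrE ?normc_ge0 ?(ltW d20)//.
  have := interior_subset Ep; rewrite /E gmulA => H.
  have := le_normcD (f (x0 *g inv p *g y)) (f x0 - f (x0 *g inv p *g y)).
  rewrite addrC subrK normc_subC => H1.
  have H2 : normc (f x0) = d + d by rewrite /d -splitr.
  by move: H H1; rewrite H2; lra.
have := cint_ge0 mu Fd.
rewrite cintB ?F0 ?cint_cst; last 2 first.
- by apply/group_bmeas/ctsC_sum.
- exact/group_bmeas/ctsC_cst.
by rewrite sub0r oppr_ge0 lecR leNgt exprn_gt0.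
Qed.

Lemma nsq_gt0 f x : ctsC f -> f x != 0 -> 0 < nsq f.
Proof.
move=> cf; apply: contra_neqT; rewrite lt_def nsq_ge0 andbT negbK => /eqP n0.
by apply: ip_eq0 => //; rewrite ip_nsq n0.
Qed.

Lemma cauchy_schwarz f g : ctsC f -> ctsC g ->
  normc (ip f g) ^+ 2 <= nsq f * nsq g.
Proof.
move=> cf cg; have [g0|/negbTE] := eqVneq (nsq g) 0.
  have gz x : g x = 0 by apply: ip_eq0 => //; rewrite ip_nsq g0.
  rewrite /ip (cint_ext mu (g := fun=> 0)) => [|x].
    by rewrite cint_cst normc0 expr0n g0 mulr0.
  by rewrite gz rmorph0 mulr0.
have := nsq_ge0 g; rewrite le_eqVlt eq_sym => /orP[/eqP->|gp _]; first by rewrite eqxx.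
pose c := ip f g / (nsq g)%:C.
have ch : ctsC (fun x => c * g x) by exact: ctsC_scale.
have gn0 : (nsq g)%:C != 0 by rewrite fmorph_eq0 gt_eqF.
have cE : c = ip f g * ((nsq g)^-1)%:C by rewrite fmorphV.
have E1 : c^* * ip f g = (normc (ip f g) ^+ 2 / nsq g)%:C.
  by rewrite cE rmorphM/= conj_real mulrAC [_^* * _]mulrC mulcJ -rmorphM.
have E2 : c * ip g f = (normc (ip f g) ^+ 2 / nsq g)%:C.
  by rewrite cE -(ipJ cf cg) mulrAC mulcJ -rmorphM.
have E3 : c * (c^* * (nsq g)%:C) = (normc (ip f g) ^+ 2 / nsq g)%:C.
  by rewrite mulrCA (_ : c * (nsq g)%:C = ip f g) ?E1// /c divfK.
have := ip_ge0 (fun x => f x - c * g x).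
have cfg : ctsC (fun x => f x - c * g x) by exact: ctsCB.
rewrite ipBl ?ipZl//.
rewrite !ipBr ?ipZr// !ip_nsq E1 mulrBr E2 E3 subrr subr0 -rmorphB/= ler0c subr_ge0.
by rewrite ler_pdivrMr.
Qed.

(** Cauchy-Schwarz against a translate of [g], whose norm is that of [g]. This is the passage from
    L2 bounds to uniform bounds. *)
Lemma conv_bound f g x : ctsC f -> ctsC g -> star g = g ->
  normc ((f *c g) x) ^+ 2 <= nsq f * nsq g.
Proof.
move=> cf cg sg; rewrite conv_ip sg -(nsq_transl (inv x) cg).
by apply: cauchy_schwarz => //; exact: ctsC_transl.
Qed.

End Convolution.

Arguments normc : simpl never.

(** * Limits of complex sequences and growth rates *)

Section Limits.
Variable R : realType.

Definition cvgC (u : nat -> R[i]) (l : R[i]) :=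
  forall eps : R, 0 < eps -> exists N, forall n, (N <= n)%N -> normc (u n - l) <= eps.

Definition ucvg (T : Type) (u : nat -> T -> R[i]) (f : T -> R[i]) :=
  forall eps : R, 0 < eps ->
    exists N, forall n, (N <= n)%N -> forall x, normc (u n x - f x) <= eps.

Lemma cvgC_unique u l l' : cvgC u l -> cvgC u l' -> l = l'.
Proof.
move=> ul ul'; apply/eqP; rewrite -subr_eq0; apply/eqP/normc_le_eps => e e0.
have e20 : 0 < e / 2 by rewrite divr_gt0.
have [N HN] := ul _ e20; have [N' HN'] := ul' _ e20.
rewrite -(subrK (u (maxn N N')) l) -addrA (le_trans (le_normcD _ _))//.
rewrite [leRHS]splitr; apply: lerD; last by rewrite HN'// leq_maxr.
by rewrite normc_subC HN// leq_maxl.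
Qed.

Lemma cvgC_cst l : cvgC (fun=> l) l.
Proof. by move=> e e0; exists 0%N => n _; rewrite subrr normc0 ltW. Qed.

Lemma cvgC_conj u l : cvgC u l -> cvgC (fun n => Num.conj (u n)) (Num.conj l).
Proof.
by move=> ul e e0; have [N HN] := ul e e0; exists N => n Nn;
  rewrite -rmorphB normc_conj HN.
Qed.

Lemma ucvg_cvgC T (u : nat -> T -> R[i]) f x : ucvg u f -> cvgC (fun n => u n x) (f x).
Proof.
by move=> uf e e0; have [N HN] := uf e e0; exists N => n Nn; exact: HN.
Qed.

Lemma cauchyR_cvg (u : nat -> R) :
  (forall eps : R, 0 < eps -> exists N, forall n m, (N <= n)%N -> (N <= m)%N ->
    `|u n - u m| <= eps) ->
  exists l, forall eps : R, 0 < eps -> exists N, forall n, (N <= n)%N -> `|u n - l| <= eps.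
Proof.
move=> Hu; have /cauchy_cvgP uc : cauchy (u @ \oo).
  apply/cauchy_ballP => e e0; have e20 : 0 < e / 2 by rewrite divr_gt0.
  have [N HN] := Hu _ e20.
  have nearN : \forall n \near \oo, (N <= n)%N by exact: nbhs_infty_ge.
  exists (u @` [set n | (N <= n)%N], u @` [set n | (N <= n)%N]) => /=.
    by split; apply: filterS nearN => n Nn; exists n.
  move=> [_ _]/= [[n Nn <-] [m Nm <-]].
  by apply: le_lt_trans (HN n m Nn Nm) _; rewrite ltr_pdivrMr// ltr_pMr// ltr1n.
exists (lim (u @ \oo)) => e e0.
move/cvgrPdist_le : uc => /(_ e e0) [N _ HN].
by exists N => n Nn; rewrite distrC; exact: HN.
Qed.

Lemma cauchyC_cvg (u : nat -> R[i]) :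
  (forall eps : R, 0 < eps -> exists N, forall n m, (N <= n)%N -> (N <= m)%N ->
    normc (u n - u m) <= eps) -> exists l, cvgC u l.
Proof.
move=> Hu.
have [|a Ha] := @cauchyR_cvg (fun n => complex.Re (u n)).
  move=> e e0; have [N HN] := Hu e e0; exists N => n m Nn Nm.
  apply: le_trans (HN n m Nn Nm); apply: le_trans (Re_le_normc _).
  by rewrite raddfB.
have [|b Hb] := @cauchyR_cvg (fun n => complex.Im (u n)).
  move=> e e0; have [N HN] := Hu e e0; exists N => n m Nn Nm.
  apply: le_trans (HN n m Nn Nm); apply: le_trans (Im_le_normc _).
  by rewrite raddfB.
exists (a +i* b) => e e0; have e20 : 0 < e / 2 by rewrite divr_gt0.
have [N HN] := Ha _ e20; have [N' HN'] := Hb _ e20.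
exists (maxn N N') => n; rewrite geq_max => /andP[Nn N'n].
apply: le_trans (normc_le_ReIm _) _; rewrite !raddfB/= [leRHS]splitr.
by rewrite lerD ?HN ?HN'.
Qed.

Lemma ucauchy_ucvg T (u : nat -> T -> R[i]) :
  (forall eps : R, 0 < eps -> exists N, forall n m, (N <= n)%N -> (N <= m)%N ->
    forall x, normc (u n x - u m x) <= eps) -> exists f, ucvg u f.
Proof.
move=> Hu; have Hl x : exists l, cvgC (fun n => u n x) l.
  apply: cauchyC_cvg => e e0; have [N HN] := Hu e e0.
  by exists N => n m Nn Nm; exact: HN.
have [f Hf] := choice Hl; exists f => e e0.
have [N HN] := Hu e e0; exists N => n Nn x.
apply/ler_addgt0Pl => d d0; have [N' HN'] := Hf x d d0.
rewrite -(subrK (u (maxn N N') x) (u n x)) -addrA (le_trans (le_normcD _ _))//.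
by rewrite [leRHS]addrC lerD// ?HN' ?HN ?leq_maxl ?leq_maxr.
Qed.

Lemma ucvg_cts (U : topologicalType) (u : nat -> U -> R[i]) f :
  ucvg u f -> (forall n, ctsC (u n)) -> ctsC f.
Proof.
move=> uf cu; apply: ctsCE => x e e0; have e30 : 0 < e / 3 by rewrite divr_gt0.
have [N /(_ N (leqnn _)) HN] := uf _ e30.
apply: filterS (ctsC_near x (cu N) e30) => y Hy.
have -> : f y - f x = (f y - u N y) + ((u N y - u N x) + (u N x - f x)) by ring.
rewrite (le_trans (le_normcD _ _))//.
have -> : e = e / 3 + (e / 3 + e / 3) by field.
rewrite lerD//; first by rewrite normc_subC.
by rewrite (le_trans (le_normcD _ _))// lerD.
Qed.

Lemma nonincreasing_cauchy (b : nat -> R) : (forall n, b n.+1 <= b n) ->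
  (forall n, 0 <= b n) -> forall eps : R, 0 < eps ->
  exists N, forall n m, (N <= n)%N -> (N <= m)%N -> b n - b m <= eps.
Proof.
move=> bS b0 e e0.
have b_le n m : (n <= m)%N -> b m <= b n.
  by move/subnK <-; elim: (m - n)%N => [//|k IH]; exact: le_trans (bS _) IH.
have lb : has_lbound (range b) by exists 0 => _ [n _ <-].
have [|_ [N _ <-] HN] := @inf_adherent R (range b) e e0.
  by split=> //; exists (b 0%N), 0%N.
exists N => n m Nn Nm; rewrite lerBlDr (le_trans (b_le N n Nn))//.
by rewrite (le_trans (ltW HN))// addrC lerD2l ge_inf//; exists m.
Qed.

(** The rate is the supremum of the ratios [q n], which increase by log-convexity. Iterating [q m]
    for [n.+1] steps from [a m] and comparing with submultiplicativity gives [q m ^+ n.+1 <= a n],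
    which bounds the ratios and yields the lower bound on [a n]. The shift in the exponent reflects
    that [a n] belongs to the convolution power of order [n.+1]. *)
Lemma submultiplicative_rate (a : nat -> R) : (forall n, 0 < a n) ->
  (forall n, a n.+1 ^+ 2 <= a n * a n.+2) ->
  (forall m n, a (m + n).+1 <= a m * a n) ->
  exists2 r, 0 < r & (forall n, a n.+1 <= r * a n) /\ (forall n, r ^+ n.+1 <= a n).
Proof.
move=> a0 ac am; pose q n := a n.+1 / a n.
have q0 n : 0 < q n by rewrite divr_gt0.
have aq n : a n.+1 = q n * a n by rewrite /q divfK// gt_eqF.
have qS n : q n <= q n.+1.
  rewrite /q ler_pdivrMr// mulrAC ler_pdivlMr//.
  by rewrite -expr2 [leRHS]mulrC.
have q_le m n : (m <= n)%N -> q m <= q n.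
  by move/subnK <-; elim: (n - m)%N => [//|k IH]; exact: le_trans IH (qS _).
have qa m k : q m ^+ k * a m <= a (m + k)%N.
  elim: k => [|k IH]; first by rewrite expr0 mul1r addn0.
  rewrite addnS aq exprS -mulrA ler_pM ?q_le ?leq_addr//.
    exact: ltW.
  by rewrite mulr_ge0 ?exprn_ge0 ?ltW.
have qn m n : q m ^+ n.+1 <= a n.
  rewrite -(ler_pM2r (a0 m)) (le_trans (qa m n.+1))// addnS mulrC.
  exact: am.
have ub : has_ubound (range q).
  by exists (a 0%N) => _ [m _ <-]; have := qn m 0%N; rewrite expr1.
have q_sup n : q n <= sup (range q) by apply: ub_le_sup => //; exists n.
exists (sup (range q)); first exact: lt_le_trans (q0 0%N) (q_sup 0%N).
split=> n; first by rewrite aq ler_wpM2r// ltW.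
(* The bound passes to the supremum after taking roots of order [n.+1]. *)
have rK : (a n `^ n.+1%:R^-1) ^+ n.+1 = a n.
  by rewrite -powR_mulrn ?powR_ge0// -powRrM mulVf// powRr1// ltW.
rewrite -rK lerXn2r ?nnegrE ?powR_ge0//.
  by rewrite (le_trans _ (q_sup 0%N))// ltW.
apply: ge_sup; first by exists (q 0%N), 0%N.
move=> _ [m _ <-]; rewrite leNgt; apply/negP => lt_q.
have := qn m n; rewrite -{1}rK leNgt => /negP; apply.
by rewrite ltr_pXn2r// ?nnegrE ?powR_ge0// ltW.
Qed.

End Limits.

(** * Power iteration for a self-adjoint function *)

Section TopIdempotent.
Variables (R : realType) (G : ptopologicalType) (Gs : compact_group G).
Variables (mu : probability (Borel G) R) (hmu : is_haar Gs mu).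
Local Notation "z ^*" := (Num.conj z) : complex_scope.
Local Notation "x *g y" := (gmul Gs x y) (at level 40, left associativity).
Local Notation inv := (ginv Gs).
Local Notation e := (gone Gs).
Local Notation "f *c g" := (Defs.conv Gs mu f g) (at level 40, left associativity).
Local Notation star := (star Gs).
Local Notation ip := (ip mu).
Local Notation nsq := (nsq mu).
Implicit Types (f g h : G -> R[i]).

Let cG : compact [set: G] := g_compact Gs.

Lemma nsq_le f (M : R) : ctsC f -> (forall x, normc (f x) ^+ 2 <= M) -> nsq f <= M.
Proof.
move=> cf fM.
have H x : 0 <= M%:C - f x * (f x)^* by rewrite mulcJ -rmorphB/= ler0c subr_ge0.
have := cint_ge0 mu H; rewrite cintB; last 2 first.
- exact: bmeas_cst.
- exact/(group_bmeas Gs)/ip_cts.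
by rewrite cint_cst -/(ip f f) ip_nsq -rmorphB/= ler0c subr_ge0.
Qed.

Lemma conv_lim (u v : nat -> G -> R[i]) f g x :
  (forall n, ctsC (u n)) -> (forall n, ctsC (v n)) -> ctsC f -> ctsC g ->
  ucvg u f -> ucvg v g -> cvgC (fun n => (u n *c v n) x) ((f *c g) x).
Proof.
move=> cu cv cf cg uf vg eps eps0.
have [M M0 fM] := ctsC_bounded cG cf; have [N N0 gN] := ctsC_bounded cG cg.
(* The 1 keeps [v n] bounded by [N + 1]; the other entry absorbs the factor 2 of [cint_bound]. *)
pose d := Num.min 1 (eps / (2 * (N + 1 + M))).
have NM0 : 0 < N + 1 + M by rewrite !addr_gt0.
have d0 : 0 < d by rewrite lt_min ltr01 divr_gt0// mulr_gt0.
have [n1 H1] := uf d d0; have [n2 H2] := vg d d0.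
exists (maxn n1 n2) => n; rewrite geq_max => /andP[/H1{}H1 /H2{}H2].
have dle : 2 * (d * (N + 1 + M)) <= eps.
  rewrite mulrCA -ler_pdivlMr ?mulr_gt0//.
  by rewrite /d ge_min lexx orbT.
apply: le_trans dle.
apply: (cint_bound cG) => [||y]; [exact: conv_section_cts|exact: conv_section_cts|].
set z := inv y *g x.
have -> : u n y * v n z - f y * g z = (u n y - f y) * v n z + f y * (v n z - g z) by ring.
apply: le_trans (le_normcD _ _) _; rewrite !normcM.
have vz : normc (v n z) <= N + 1.
  rewrite -(subrK (g z) (v n z)) addrC (le_trans (le_normcD _ _))// lerD//.
  by rewrite (le_trans (H2 z))// /d ge_min lexx.
rewrite mulrDr; apply: lerD; first by rewrite ler_pM ?normc_ge0.
by rewrite mulrC ler_pM ?normc_ge0.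
Qed.

Variables (h : G -> R[i]) (ch : ctsC h) (sh : star h = h).

(* convpow n is the (n+1)-st convolution power of h. *)
Definition convpow n := iter n (Defs.conv Gs mu h) h.

Lemma convpow_cts n : ctsC (convpow n).
Proof. by elim: n => [//|n IH]; exact: ctsC_conv. Qed.

Lemma convpow_conv m n : convpow m *c convpow n = convpow (m + n).+1.
Proof.
elim: m => [//|m IH]; rewrite addSn [in RHS]/convpow iterS -/(convpow _) -IH.
by rewrite -(convfA hmu)//; exact: convpow_cts.
Qed.

Lemma convpow_star n : star (convpow n) = convpow n.
Proof.
elim: n => [//|n IH]; rewrite {1}/convpow iterS -/(convpow _).
rewrite (star_conv hmu)//; last exact: convpow_cts.
by rewrite IH sh -[h]/(convpow 0) convpow_conv addn0.
Qed.

Lemma ip_convpow m n : ip (convpow m) (convpow n) = convpow (m + n).+1 e.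
Proof. by rewrite (ip_conv Gs) convpow_star convpow_conv. Qed.

Hypothesis h0 : exists x, h x != 0.

Lemma nsq_convpow_gt0 n : 0 < nsq (convpow n).
Proof.
elim: n => [|n IH]; first by case: h0 => x; exact: (nsq_gt0 hmu).
rewrite lt_def nsq_ge0 andbT; apply/negP => /eqP n0.
have z0 x : convpow n.+1 x = 0.
  by apply: (ip_eq0 hmu); [exact: convpow_cts|rewrite ip_nsq n0].
(* A vanishing power makes all later ones vanish, among them the one whose value at the identity is
   the squared norm of [convpow n]. *)
have zk k x : convpow (n.+1 + k) x = 0.
  elim: k x => [|k IHk] x; first by rewrite addn0.
  rewrite addnS /convpow iterS -/(convpow _) /Defs.conv.
  rewrite (cint_ext mu (g := fun=> 0)) ?cint_cst// => y.
  by rewrite IHk mulr0.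
have := zk n e; rewrite addSn -ip_convpow ip_nsq => /eqP.
by rewrite fmorph_eq0 gt_eqF.
Qed.

(* p is the limit of lam^-(n+1) h^(2n+2), where lam is the growth rate of the
   squared L2 norms of the convolution powers: these norms are log-convex by
   Cauchy-Schwarz and submultiplicative, which gives both bounds on the rate. The
   last clause transfers invariance properties of h to p. *)
Lemma top_idempotent : exists (p : G -> R[i]) (lam : R),
  [/\ ctsC p, star p = p, p *c p = p & exists x, p x != 0] /\
  [/\ 0 < lam, (h *c h) *c p = (fun x => lam%:C * p x) &
    forall x y, (forall n, convpow n x = convpow n y) -> p x = p y].
Proof.
pose a n := nsq (convpow n).
have a0 n : 0 < a n by exact: nsq_convpow_gt0.
have aE n : (a n)%:C = convpow (n + n).+1 e by rewrite -ip_nsq ip_convpow.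
have [|m n|lam lam0 [aS alam]] := @submultiplicative_rate R a a0.
- move=> n; have := cauchy_schwarz hmu (convpow_cts n) (convpow_cts n.+2).
  rewrite ip_convpow -[(n + n.+2)%N]/(n + n.+2)%N addnS -addSn -aE normc_real.
  by rewrite ger0_norm// ltW.
- rewrite /a -convpow_conv; apply: nsq_le => [|x].
    by apply: ctsC_conv; exact: convpow_cts.
  by apply: (conv_bound hmu); rewrite ?convpow_star//; exact: convpow_cts.
(* The two bounds on the rate make [b] nonincreasing and at least 1, hence Cauchy with a nonzero
   limit. *)
pose b n := a n / lam ^+ n.+1.
have lamX n : 0 < lam ^+ n by rewrite exprn_gt0.
have bS n : b n.+1 <= b n.
  rewrite /b exprS invfM mulrA ler_wpM2r ?invr_ge0 ?(ltW (lamX _))//.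
  by rewrite ler_pdivrMr// mulrC.
have b1 n : 1 <= b n by rewrite /b ler_pdivlMr// mul1r.
pose P n x := (lam ^- n.+1)%:C * convpow (n + n).+1 x.
have cP n : ctsC (P n) by apply: ctsC_scale; exact: convpow_cts.
have sP n : star (P n) = P n by rewrite star_scale conj_real convpow_star.
(* Inner products depend only on [n + m], so the squared distance of [P n] and [P m] is a
   combination of differences of [b]. *)
have ipP n m : ip (P n) (P m) = (b (n + m).+1)%:C.
  rewrite ipZl ?ipZr ?conj_real ?ip_convpow//; try exact: convpow_cts.
  have -> : ((n + n).+1 + (m + m).+1).+1 = ((n + m).+1 + (n + m).+1).+1 by lia.
  rewrite -aE -!rmorphM/= mulrA -invfM -exprD mulrC; congr (_ / _ ^+ _)%:C; lia.
have nP n m : nsq (fun x => P n x - P m x) =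
    (b (n + n).+1 - b (n + m).+1) + (b (m + m).+1 - b (n + m).+1).
  have cPP : ctsC (fun x => P n x - P m x) by exact: ctsCB.
  apply: complexI; rewrite -ip_nsq ipBl// !ipBr// !ipP (addnC m n).
  have aux (x y z : R) : x%:C - y%:C - (y%:C - z%:C) = ((x - y) + (z - y))%:C.
    by apply: eq_ReIm => /=; [rewrite opprB addrA|rewrite !subr0].
  exact: aux.
have cc m n : (lam ^- m.+1)%:C * (lam ^- n.+1)%:C = (lam ^- (m + n).+2)%:C.
  by rewrite -rmorphM -invfM -exprD addSn addnS.
have PP m n : P m *c P n = P (m + n).+1.
  rewrite convZl ?convZr ?convpow_conv//; try exact: convpow_cts.
  have -> : ((m + m).+1 + (n + n).+1).+1 = ((m + n).+1 + (m + n).+1).+1 by lia.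
  by apply/funext => x; rewrite mulrA cc.
have P0E : P 0%N = (fun x => (lam^-1)%:C * (h *c h) x).
  by apply/funext => x; rewrite /P expr1.
have [|p uP] := @ucauchy_ucvg R G P.
  move=> eps eps0.
  have C0 : 0 <= nsq (P 0%N) by exact: nsq_ge0.
  pose d := eps ^+ 2 / (nsq (P 0%N) + 1) / 2.
  have d0 : 0 < d by rewrite !divr_gt0 ?exprn_gt0// ltr_wpDl.
  have [N HN] := nonincreasing_cauchy bS (fun n => le_trans ler01 (b1 n)) d0.
  (* The shift by one is the price of uniformity: [P n.+1] is [P 0 * P n], so [conv_bound] applies
     to [P 0] and the difference. *)
  exists N.+1 => -[//|n] [//|m]; rewrite !ltnS => Nn Nm x.
  rewrite -(@ler_pXn2r _ 2) ?nnegrE ?normc_ge0 ?(ltW eps0)//.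
  rewrite -(add0n n) -(add0n m) -!PP -[_ - _]/((fun x => _ - _) x) -convBr//.
  apply: le_trans (conv_bound hmu x _ _ _) _ => //.
  - exact: ctsCB.
  - by rewrite star_sub !sP.
  rewrite nP.
  have : nsq (P 0%N) * (d + d) <= eps ^+ 2.
    rewrite -splitr mulrCA ler_piMr ?sqr_ge0// ler_pdivrMr ?mul1r ?lerDl//.
    by rewrite ltr_wpDl.
  apply: le_trans; rewrite ler_wpM2l// lerD// HN//; lia.
have cp : ctsC p by exact: ucvg_cts uP cP.
have ucst f : ucvg (fun=> f) f.
  by move=> eps eps0; exists 0%N => n _ x; rewrite subrr normc0 ltW.
have Pp m : P m *c p = p.
  apply/funext => x; apply: cvgC_unique (ucvg_cvgC x (_ : ucvg (fun n => P (m + n).+1) p)).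
    rewrite -[X in cvgC X _](_ : (fun n => (P m *c P n) x) = _).
      exact: conv_lim.
    by apply/funext => n; rewrite PP.
  move=> eps eps0; have [N HN] := uP eps eps0; exists N => n Nn y.
  by apply: HN; lia.
exists p, lam; split; split=> //.
- apply/funext => x; apply: (@cvgC_unique _ (fun n => P n x)).
    rewrite -[X in cvgC X _](_ : (fun n => star (P n) x) = _).
      by apply: cvgC_conj; exact: (ucvg_cvgC (inv x) uP).
    by apply/funext => n; rewrite sP.
  exact: ucvg_cvgC uP.
- apply/funext => x; apply: (@cvgC_unique _ (fun=> p x)); last exact: cvgC_cst.
  rewrite -[X in cvgC X _](_ : (fun n => (P n *c p) x) = _).
    exact: conv_lim.
  by apply/funext => n; rewrite Pp.
(* The value of [P n] at the identity is [b n], at least 1, so the limit cannot vanish there. *)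
- exists e; apply/eqP => pe0.
  have h20 : 0 < 2^-1 :> R by rewrite invr_gt0.
  have [N /(_ N (leqnn _))] := ucvg_cvgC e uP h20.
  rewrite pe0 subr0 /P -aE -rmorphM/= normc_real mulrC -/(b N) ger0_norm.
    by rewrite leNgt (lt_le_trans _ (b1 N))// invf_lt1 ?ltr1n.
  exact: le_trans (b1 N).
- have := Pp 0%N; rewrite P0E convZl//; last exact: ctsC_conv.
  move/(congr1 (fun f x => lam%:C * f x)) => <-; apply/funext => x.
  by rewrite mulrA -rmorphM/= mulfV ?gt_eqF// mul1r.
- move=> x y xy; apply: cvgC_unique (ucvg_cvgC x uP) _.
  rewrite -[X in cvgC X _](_ : (fun n => P n y) = _); first exact: ucvg_cvgC uP.
  by apply/funext => n; rewrite /P xy.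
Qed.

End TopIdempotent.

(** * Unconditional sums *)

Section Series.
Variables (R : realType) (I : Type) (A : set I).
Implicit Types (l : seq I).

Lemma fin_sub_nil : fin_sub A [::].
Proof. by split; [exact: List.NoDup_nil|]. Qed.

Lemma fin_sub_seq1 i : A i -> fin_sub A [:: i].
Proof.
move=> Ai; split=> [|j [<-|[]]//].
by apply: List.NoDup_cons; [case|exact: List.NoDup_nil].
Qed.

Lemma eq_big_In (V : nmodType) l (F H : I -> V) :
  (forall i, List.In i l -> F i = H i) -> \sum_(i <- l) F i = \sum_(i <- l) H i.
Proof.
elim: l => [|i l IH] FH; first by rewrite !big_nil.
by rewrite !big_cons FH; [rewrite IH// => j jl; apply: FH; right|left].
Qed.

Lemma ler_sum_In (V : numDomainType) l (F H : I -> V) :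
  (forall i, List.In i l -> F i <= H i) -> \sum_(i <- l) F i <= \sum_(i <- l) H i.
Proof.
elim: l => [|i l IH] FH; first by rewrite !big_nil.
rewrite !big_cons lerD//; first by apply: FH; left.
by apply: IH => j jl; apply: FH; right.
Qed.

(** The index type has no decidable equality, so membership is decided classically. *)
Definition diffl l l0 := List.filter (fun i => `[< ~ List.In i l0 >]) l.

Lemma in_diffl l l0 i : List.In i (diffl l l0) <-> List.In i l /\ ~ List.In i l0.
Proof.
rewrite /diffl List.filter_In; split=> -[H1 H2]; split=> //; exact/asboolP.
Qed.

Lemma fin_sub_diffl l l0 : fin_sub A l -> fin_sub A (diffl l l0).
Proof.
move=> [nl Al]; split; first exact: List.NoDup_filter.
by move=> i /in_diffl[/Al].
Qed.

Lemma fin_sub_join l0 l : fin_sub A l0 -> fin_sub A l ->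
  (forall i, List.In i l0 -> ~ List.In i l) -> fin_sub A (l0 ++ l).
Proof.
move=> [n0 A0] [nl Al] dis; split.
  elim: l0 n0 A0 dis => [//|i l0 IH] n0 A0 dis /=; inversion n0; subst.
  apply: List.NoDup_cons; last first.
    by apply: IH => // [j jl|j jl]; [apply: A0; right|apply: dis; right].
  move=> /List.in_app_iff[//|il]; apply: (dis i) => //; by left.
by move=> i /List.in_app_iff[/A0|/Al].
Qed.

Lemma fin_sub_union l l' : fin_sub A l -> fin_sub A l' ->
  exists l'', [/\ fin_sub A l'', forall i, List.In i l -> List.In i l'' &
    forall i, List.In i l' -> List.In i l''].
Proof.
move=> fl fl'; exists (l ++ diffl l' l); split.
- apply: fin_sub_join => //; first exact: fin_sub_diffl.
  by move=> i il /in_diffl[].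
- by move=> i il; apply/List.in_app_iff; left.
- move=> i il; apply/List.in_app_iff; have [?|?] := pselect (List.In i l); first by left.
  by right; apply/in_diffl.
Qed.

Lemma big_Permutation (V : nmodType) l l' (F : I -> V) :
  Permutation.Permutation l l' -> \sum_(i <- l) F i = \sum_(i <- l') F i.
Proof.
elim=> [|i s t _ IH|i j s|s t r _ IH1 _ IH2].
- by rewrite !big_nil.
- by rewrite !big_cons IH.
- by rewrite !big_cons addrCA.
- by rewrite IH1 IH2.
Qed.

Lemma sum_diffl (V : nmodType) l l0 (F : I -> V) : fin_sub A l -> fin_sub A l0 ->
  (forall i, List.In i l0 -> List.In i l) ->
  \sum_(i <- l) F i = \sum_(i <- l0) F i + \sum_(i <- diffl l l0) F i.
Proof.
move=> fl fl0 l0l; rewrite -big_cat; apply: big_Permutation.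
apply: Permutation.NoDup_Permutation; first by case: fl.
  have [|//] := @fin_sub_join l0 (diffl l l0) fl0 (fin_sub_diffl l0 fl).
  by move=> i il /in_diffl[].
move=> i; split=> [il|/List.in_app_iff[/l0l//|/in_diffl[]//]].
apply/List.in_app_iff; have [?|?] := pselect (List.In i l0); first by left.
by right; apply/in_diffl.
Qed.

Lemma has_sum_unique (a : I -> R[i]) s t : has_sum A a s -> has_sum A a t -> s = t.
Proof.
move=> hs ht; apply/eqP; rewrite -subr_eq0; apply/eqP/normc_le_eps => e e0.
have e20 : 0 < e / 2 by rewrite divr_gt0.
have [l [fl Hl]] := hs _ e20; have [l' [fl' Hl']] := ht _ e20.
have [m [fm lm l'm]] := fin_sub_union fl fl'.
have := Hl m fm lm; have := Hl' m fm l'm; rewrite !normcR !ltcR => H1 H2.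
rewrite -(subrK (\sum_(i <- m) a i) s) -addrA (le_trans (le_normcD _ _))//.
by rewrite [leRHS]splitr lerD ?(ltW H1)// normc_subC ltW.
Qed.

Lemma has_sum_ext (a b : I -> R[i]) s : (forall i, A i -> a i = b i) ->
  has_sum A a s -> has_sum A b s.
Proof.
move=> ab hs e e0; have [l [fl Hl]] := hs e e0; exists l; split=> // m fm lm.
by rewrite -(@eq_big_In _ m a b) ?Hl// => i /(fm.2 i)/ab.
Qed.

Lemma has_sum0 : has_sum A (fun=> 0 : R[i]) 0.
Proof.
move=> e e0; exists [::]; split=> [|l _ _]; first exact: fin_sub_nil.
by rewrite big1// subrr normr0 ltcR.
Qed.

Lemma has_sumD (a b : I -> R[i]) s t : has_sum A a s -> has_sum A b t ->
  has_sum A (fun i => a i + b i) (s + t).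
Proof.
move=> hs ht e e0; have e20 : 0 < e / 2 by rewrite divr_gt0.
have [l [fl Hl]] := hs _ e20; have [l' [fl' Hl']] := ht _ e20.
have [m [fm lm l'm]] := fin_sub_union fl fl'; exists m; split=> // k fk mk.
have := Hl k fk (fun i il => mk i (lm i il)).
have := Hl' k fk (fun i il => mk i (l'm i il)).
rewrite big_split/= !normcR !ltcR => H1 H2.
rewrite opprD addrACA (le_lt_trans (le_normcD _ _))//.
by rewrite [ltRHS]splitr ltrD.
Qed.

Lemma has_sumZ c (a : I -> R[i]) s : has_sum A a s ->
  has_sum A (fun i => c * a i) (c * s).
Proof.
move=> hs e e0; have c1 : 0 < normc c + 1 by rewrite ltr_wpDl// normc_ge0.
have [l [fl Hl]] := hs _ (divr_gt0 e0 c1); exists l; split=> // m fm lm.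
have := Hl m fm lm; rewrite -mulr_sumr -mulrBr !normcR !ltcR normcM => H.
rewrite (le_lt_trans (ler_wpM2l (normc_ge0 _) (ltW H)))//.
by rewrite mulrCA gtr_pMr// ltr_pdivrMr// mul1r ltrDl.
Qed.

Lemma has_sum_sum (T : Type) (r : seq T) (a : T -> I -> R[i]) (s : T -> R[i]) :
  (forall j, has_sum A (a j) (s j)) ->
  has_sum A (fun i => \sum_(j <- r) a j i) (\sum_(j <- r) s j).
Proof.
move=> H; elim: r => [|j r IH].
  by rewrite big_nil; apply: has_sum_ext has_sum0 => i _; rewrite big_nil.
rewrite big_cons; apply: has_sum_ext (has_sumD (H j) IH) => i _.
by rewrite big_cons.
Qed.

Lemma has_sum_ge0 (a : I -> R[i]) s : (forall i, A i -> 0 <= a i) ->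
  has_sum A a s -> 0 <= s.
Proof.
move=> a0 hs.
have key e : 0 < e -> - e <= complex.Re s /\ `|complex.Im s| <= e.
  move=> e0; have [l [fl Hl]] := hs e e0; have := Hl l fl (fun i il => il).
  have := @ler_sum_In _ l (fun=> 0) a (fun i il => a0 i (fl.2 i il)).
  rewrite big1//.
  move: (\sum_(i <- l) a i) => z; rewrite lecE => /andP[/eqP iz rz].
  rewrite normcR ltcR => /ltW H.
  have := le_trans (Re_le_normc _) H; have := le_trans (Im_le_normc _) H.
  rewrite !raddfB/= iz sub0r normrN => -> /=; rewrite ler_norml => /andP[_].
  by move: rz => /=; lra.
rewrite lecE; apply/andP; split.
  apply/eqP/eqP; rewrite -normr_eq0 eq_le normr_ge0 andbT.
  by apply/ler_addgt0Pl => e e0; rewrite addr0; case: (key e e0).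
apply/ler_addgt0Pl => e e0; have [+ _] := key e e0.
by rewrite -subr_ge0 opprK addrC.
Qed.

(** One finite set must serve all points; pointwise sums would not allow integration of the
    limit. *)
Definition unif_sum (T : Type) (a : I -> T -> R[i]) (s : T -> R[i]) :=
  forall eps : R, 0 < eps -> exists l0, fin_sub A l0 /\
    forall l, fin_sub A l -> (forall i, List.In i l0 -> List.In i l) ->
      forall x, normc (\sum_(i <- l) a i x - s x) <= eps.

Lemma unif_sum_has_sum T (a : I -> T -> R[i]) s x :
  unif_sum a s -> has_sum A (fun i => a i x) (s x).
Proof.
move=> us e e0; have e20 : 0 < e / 2 by rewrite divr_gt0.
have [l [fl Hl]] := us _ e20; exists l; split=> // m fm lm.
rewrite normcR ltcR (le_lt_trans (Hl m fm lm x))//.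
by rewrite ltr_pdivrMr// ltr_pMr// ltr1n.
Qed.

Section Dominated.
Variables (D : I -> R) (M : R).
Hypothesis DM : forall l, fin_sub A l -> \sum_(i <- l) D i <= M.

Lemma dominated_tail (eps : R) : 0 < eps -> exists l0, fin_sub A l0 /\
  forall l, fin_sub A l -> (forall i, List.In i l0 -> List.In i l) ->
    \sum_(i <- diffl l l0) D i <= eps.
Proof.
move=> eps0; pose S := [set \sum_(i <- l) D i | l in fin_sub A].
have hS : has_sup S.
  split; first by exists (\sum_(i <- [::]) D i), [::] => //; exact: fin_sub_nil.
  by exists M => _ [l fl <-]; exact: DM.
have [_ [l0 fl0 <-] H] := sup_adherent eps0 hS.
exists l0; split=> // l fl l0l.
have : \sum_(i <- l) D i <= sup S by apply: ub_le_sup; [case: hS|exists l].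
by rewrite (sum_diffl D fl fl0 l0l); move: H; lra.
Qed.

Variables (T : Type) (a : I -> T -> R[i]).
Hypothesis aD : forall i x, A i -> normc (a i x) <= D i.

Lemma dominated_cauchy (eps : R) : 0 < eps -> exists l0, fin_sub A l0 /\
  forall l, fin_sub A l -> (forall i, List.In i l0 -> List.In i l) ->
    forall x, normc (\sum_(i <- l) a i x - \sum_(i <- l0) a i x) <= eps.
Proof.
move=> eps0; have [l0 [fl0 H]] := dominated_tail eps0.
exists l0; split=> // l fl l0l x; apply: le_trans (H l fl l0l).
rewrite (sum_diffl _ fl fl0 l0l) addrAC subrr add0r.
apply: le_trans (normc_sum _ _) _; apply: ler_sum_In => i /in_diffl[/(fl.2 i) Ai _].
exact: aD.
Qed.

(** The limit is built along finite sets [l n] whose tails are at most [n.+1%:R^-1]. Two of them are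
    compared through a common superset, and any finite set containing [l n] stays close to its
    partial sum, so the sequence controls the whole net. *)
Lemma dominated_unif_sum : exists s, unif_sum a s.
Proof.
have e_gt0 n : 0 < (n.+1%:R : R)^-1 by rewrite invr_gt0 ltr0n.
have [l Hl] := choice (fun n => dominated_cauchy (e_gt0 n)).
pose u n x := \sum_(i <- l n) a i x.
have uu n m x : normc (u n x - u m x) <= n.+1%:R^-1 + m.+1%:R^-1.
  have [k [fk nk mk]] := fin_sub_union (Hl n).1 (Hl m).1.
  have -> : u n x - u m x = (u n x - \sum_(i <- k) a i x) + (\sum_(i <- k) a i x - u m x).
    by rewrite addrA subrK.
  rewrite (le_trans (le_normcD _ _))// lerD//; last exact: (Hl m).2.
  by rewrite normc_subC; exact: (Hl n).2.
have small (e : R) : 0 < e -> exists N, forall n, (N <= n)%N -> n.+1%:R^-1 <= e / 2.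
  move=> e0; exists (Num.truncn (2 / e)) => n Nn.
  rewrite -[e / 2]invrK lef_pV2 ?posrE ?invr_gt0 ?divr_gt0 ?ltr0n// invf_div.
  by rewrite (le_trans (ltW (truncnS_gt _)))// ler_nat.
have [|s us] := @ucauchy_ucvg R T u.
  move=> e e0; have [N HN] := small e e0; exists N => n m Nn Nm x.
  by rewrite (le_trans (uu n m x))// [leRHS]splitr lerD// HN.
exists s => e e0; have [N HN] := small e e0.
have e20 : 0 < e / 2 by rewrite divr_gt0.
have [N' HN'] := us _ e20; pose n := maxn N N'.
exists (l n); split=> [|k fk nk x]; first exact: (Hl n).1.
have -> : \sum_(i <- k) a i x - s x = (\sum_(i <- k) a i x - u n x) + (u n x - s x).
  by rewrite addrA subrK.
rewrite (le_trans (le_normcD _ _))// [leRHS]splitr lerD//.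
  by rewrite (le_trans ((Hl n).2 k fk nk x))// HN// leq_maxl.
by rewrite HN'// leq_maxr.
Qed.

Lemma dominated_has_sum s : (forall x, has_sum A (fun i => a i x) (s x)) -> unif_sum a s.
Proof.
move=> hs; have [t ut] := dominated_unif_sum.
suff -> : s = t by [].
apply/funext => x; apply: has_sum_unique (hs x) _.
exact: (unif_sum_has_sum x ut).
Qed.

End Dominated.

(** Turns the net into a sequence for use under an integral. Prescribing [l1] keeps a chosen term
    present in every partial sum. *)
Lemma unif_sum_ucvg (T : Type) (a : I -> T -> R[i]) s l1 : unif_sum a s -> fin_sub A l1 ->
  exists l : nat -> seq I,
    (forall n, fin_sub A (l n) /\ forall i, List.In i l1 -> List.In i (l n)) /\
    ucvg (fun n x => \sum_(i <- l n) a i x) s.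
Proof.
move=> us fl1; have e_gt0 n : 0 < (n.+1%:R : R)^-1 by rewrite invr_gt0 ltr0n.
have H n : exists k, [/\ fin_sub A k, forall i, List.In i l1 -> List.In i k &
    forall x, normc (\sum_(i <- k) a i x - s x) <= n.+1%:R^-1].
  have [l0 [fl0 Hl0]] := us _ (e_gt0 n).
  have [k [fk l0k l1k]] := fin_sub_union fl0 fl1.
  by exists k; split=> // x; exact: Hl0.
have [l Hl] := choice H; exists l; split=> [n|e e0]; first by case: (Hl n).
exists (Num.truncn e^-1) => n Nn x; case: (Hl n) => _ _ /(_ x) /le_trans; apply.
rewrite -[e]invrK lef_pV2 ?posrE ?invr_gt0 ?ltr0n//.
by rewrite (le_trans (ltW (truncnS_gt _)))// ler_nat.
Qed.

End Series.

(** * Gelfand pairs and positive definite spherical functions *)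

Section PositiveDefinite.
Variables (R : realType) (Y : Type) (k : Y -> Y -> R[i]) (hk : pd_kernel k).
Local Notation "z ^*" := (Num.conj z) : complex_scope.

(** Allows tests indexed by [bool] and by pairs of ordinals. *)
Lemma pd_fin (T : finType) (y : T -> Y) (c : T -> R[i]) :
  0 <= \sum_j \sum_l k (y j) (y l) * c j * (c l)^*.
Proof.
have := hk (fun i : 'I_#|T| => y (enum_val i)) (fun i => c (enum_val i)).
congr (0 <= _); rewrite [RHS](reindex_onto enum_val enum_rank)/=; last first.
  by move=> i _; rewrite enum_rankK.
apply: eq_big => [i|i _]; first by rewrite enum_valK eqxx.
rewrite [RHS](reindex_onto enum_val enum_rank)/=; last first.
  by move=> l _; rewrite enum_rankK.
by apply: eq_bigl => l; rewrite enum_valK eqxx.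
Qed.

Lemma pd_extend y0 c0 n (y : 'I_n -> Y) (c : 'I_n -> R[i]) :
  0 <= k y0 y0 * c0 * c0^* + \sum_l k y0 (y l) * c0 * (c l)^* +
    (\sum_j k (y j) y0 * c j * c0^* + \sum_j \sum_l k (y j) (y l) * c j * (c l)^*).
Proof.
have := hk (fun i : 'I_n.+1 => oapp y y0 (unlift ord0 i))
  (fun i => oapp c c0 (unlift ord0 i)).
congr (0 <= _); rewrite big_ord_recl; congr (_ + _).
  rewrite big_ord_recl unlift_none /=; congr (_ + _).
  by apply: eq_bigr => l _; rewrite liftK.
rewrite -big_split; apply: eq_bigr => j _ /=.
rewrite big_ord_recl unlift_none liftK /=; congr (_ + _).
by apply: eq_bigr => l _; rewrite liftK.
Qed.

Lemma pd_two x y (a b : R[i]) :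
  0 <= k x x * a * a^* + k x y * a * b^* + (k y x * b * a^* + k y y * b * b^*).
Proof.
have := pd_fin (fun i : bool => if i then x else y) (fun i => if i then a else b).
by rewrite !big_bool.
Qed.

Lemma pd_diag x : 0 <= k x x.
Proof.
have := pd_two x x 1 0.
by rewrite rmorph1 rmorph0 !(mulr0, mulr1, addr0).
Qed.

(** The coefficients (1, 1) and (1, i) give two forms whose imaginary parts must vanish. *)
Lemma pd_herm x y : k y x = (k x y)^*.
Proof.
have dx := ger0_Im (pd_diag x); have dy := ger0_Im (pd_diag y).
have := ger0_Im (pd_two x y 1 1); have := ger0_Im (pd_two x y 1 'i).
case: (k x y) (k y x) (k x x) (k y y) dx dy => [a b] [c d] [e f] [g h] /= -> ->.
by move=> H1 H2; apply: eq_ReIm => /=; lra.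
Qed.

(** An additive form of Cauchy-Schwarz: it bounds off-diagonal entries by a sum of diagonal ones,
    which is the shape that domination of series requires. *)
Lemma pd_normc x y : 2 * normc (k x y) <= complex.Re (k x x) + complex.Re (k y y).
Proof.
(* With r the modulus of [k x y], these coefficients turn the form into r^2 (k x x + k y y) - 2
   r^3. *)
have := pd_two x y (- (k x y)^*) (normc (k x y))%:C.
rewrite (pd_herm x y) rmorphN/= conjCK conj_real.
have -> : k x x * - (k x y)^* * - k x y = k x x * (normc (k x y) ^+ 2)%:C.
  by rewrite -mulrA mulrNN [_^* * _]mulrC mulcJ.
have -> : k x y * - (k x y)^* * (normc (k x y))%:C = - (normc (k x y) ^+ 3)%:C.
  by rewrite mulrN mulNr mulcJ -rmorphM/= -exprSr.
have -> : (k x y)^* * (normc (k x y))%:C * - k x y = - (normc (k x y) ^+ 3)%:C.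
  by rewrite mulrN mulrAC [_^* * _]mulrC mulcJ -rmorphM/= -exprSr.
have := pd_diag x; have := pd_diag y; rewrite !lecE => /andP[_ +] /andP[_ +] /andP[_].
have := normc_ge0 (k x y); move: (normc _) => r; case: (k x x) (k y y) => [a b] [c d] /=.
rewrite le_eqVlt => /orP[/eqP<- c0 a0 _|r0 _ _]; last first.
  by rewrite -(ler_pM2r (exprn_gt0 2 r0)); lra.
by rewrite mulr0 addr_ge0.
Qed.

End PositiveDefinite.

Section GelfandPair.
Variables (R : realType) (G : ptopologicalType) (Gs : compact_group G).
Variables (mu : probability (Borel G) R) (hmu : is_haar Gs mu).
Variables (K : set G) (hK : closed_subgroup Gs K).
Variables (nu : probability (Borel G) R) (hnu : is_haar_on Gs K nu).
Variable hGK : gelfand_pair Gs mu K.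
Local Notation "z ^*" := (Num.conj z) : complex_scope.
Local Notation "x *g y" := (gmul Gs x y) (at level 40, left associativity).
Local Notation inv := (ginv Gs).
Local Notation e := (gone Gs).
Local Notation "f *c g" := (Defs.conv Gs mu f g) (at level 40, left associativity).
Local Notation star := (star Gs).
Local Notation ip := (ip mu).
Local Notation nsq := (nsq mu).
Local Notation I := (cint mu).
Implicit Types (f g h p q : G -> R[i]).

Let cG : compact [set: G] := g_compact Gs.
Let cts_bmeas f : ctsC f -> bmeas f := @group_bmeas R G Gs f.

Definition biK f := ctsC f /\ bi_invariant Gs K f.

Lemma K1 : K e. Proof. by case: hK. Qed.
Lemma KV k : K k -> K (inv k). Proof. by case: hK => _ _ _; exact. Qed.

Lemma measurableK : measurable (K : set (Borel G)).
Proof.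
rewrite -[K]setCK; apply: measurableC; apply: sub_sigma_algebra.
by apply: closed_openC; case: hK.
Qed.

Lemma biK_l f k x : biK f -> K k -> f (k *g x) = f x.
Proof. by move=> [_ H] Kk; rewrite -{1}(gmulg1 Gs x) gmulA H//; exact: K1. Qed.

Lemma biK_r f k x : biK f -> K k -> f (x *g k) = f x.
Proof. by move=> [_ H] Kk; rewrite -{1}(gmul1g Gs x) H//; exact: K1. Qed.

Lemma biKI f : ctsC f -> (forall k x, K k -> f (k *g x) = f x) ->
  (forall k x, K k -> f (x *g k) = f x) -> biK f.
Proof. by move=> cf fl fr; split=> // k l x Kk Kl; rewrite fr// fl. Qed.

Lemma biKZ c f : biK f -> biK (fun x => c * f x).
Proof.
by move=> [cf H]; split=> [|k l x Kk Kl]; [exact: ctsC_scale|rewrite H].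
Qed.

Lemma biKD f g : biK f -> biK g -> biK (fun x => f x + g x).
Proof.
by move=> [cf Hf] [cg Hg]; split=> [|k l x Kk Kl]; [exact: ctsCD|rewrite Hf ?Hg].
Qed.

Lemma biKB f g : biK f -> biK g -> biK (fun x => f x - g x).
Proof.
by move=> [cf Hf] [cg Hg]; split=> [|k l x Kk Kl]; [exact: ctsCB|rewrite Hf ?Hg].
Qed.

Lemma biKJ f : biK f -> biK (fun x => (f x)^*).
Proof. by move=> [cf H]; split=> [|k l x Kk Kl]; [exact: ctsCJ|rewrite H]. Qed.

Lemma biK_star f : biK f -> biK (star f).
Proof.
move=> bf; have [cf H] := bf; split=> [|k l x Kk Kl]; first exact: ctsC_star.
by rewrite /star !ginvM gmulA H//; exact: KV.
Qed.

Lemma biK_conv f g : biK f -> biK g -> biK (f *c g).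
Proof.
move=> bf bg; have cf := bf.1; have cg := bg.1.
apply: biKI => [|k x Kk|k x Kk]; first exact: ctsC_conv.
  rewrite /Defs.conv.
  rewrite -(haar_transl hmu (f := fun y => f y * g (inv y *g (k *g x))) k).
    by apply: cint_ext => y; rewrite biK_l// ginvM -!gmulA gmulKg.
  exact: conv_section_cts.
by apply: cint_ext => y; rewrite gmulA biK_r.
Qed.

Lemma biK_convC f g : biK f -> biK g -> f *c g = g *c f.
Proof. by move=> [cf Hf] [cg Hg]; apply: hGK => //; exact/contCP. Qed.

Lemma nu_transl f k : ctsC f -> K k -> cint nu (fun x => f (k *g x)) = cint nu f.
Proof.
move=> cf Kk; apply: cint_pushforward (cts_bmeas cf) => [|A mA]; last exact: hnu.2.
by apply: mul_cts; [exact: cst_cts|exact: id_cts].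
Qed.

Lemma mulxky_cts f (x y : G) : ctsC f -> ctsC (fun k => f (x *g k *g y)).
Proof.
move=> cf; apply: (ctsC_comp _ cf); apply: mul_cts; last exact: cst_cts.
by apply: mul_cts; [exact: cst_cts|exact: id_cts].
Qed.

(* Averaging over K is free against a left K-invariant f. *)
Lemma conv_average f g x : biK f -> ctsC g ->
  (f *c g) x = I (fun y => f y * cint nu (fun k => g (inv y *g k *g x))).
Proof.
move=> bf cg; have cf := bf.1.
have cF : ctsC (fun z : G * G => f z.2 * g (inv z.2 *g z.1 *g x)).
  apply: ctsCM; first exact: (ctsC_comp (@snd_cts _ _) cf).
  apply: (ctsC_comp _ cg); apply: mul_cts; last exact: cst_cts.
  by apply: mul_cts; [apply: inv_cts; exact: snd_cts|exact: fst_cts].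
transitivity (cint nu (fun k => I (fun y => f y * g (inv y *g k *g x)))).
  (* The left side is integrated over [nu] as a constant. For [k] in [K] the substitution of
     [k *g y] for [y] is absorbed by the invariance of [f]. *)
  rewrite -[LHS](cint_cst nu); apply: (eq_cint_on measurableK hnu.1).
  - exact: bmeas_cst.
  - exact/cts_bmeas/(ctsC_cint cG mu (ctsC_comp (@swap_cts _) cF)).
  move=> k Kk; rewrite -(haar_transl hmu (f := fun y => f y * g (inv y *g k *g x)) k).
    by apply: cint_ext => y /=; rewrite (biK_l y bf Kk) ginvM -!gmulA gmulKg.
  exact: (ctsC_comp (@pair_cts _ k) cF).
rewrite -(fubini_cts cG nu mu cF); apply: cint_ext => y /=.
by rewrite cintZ//; exact/cts_bmeas/mulxky_cts.
Qed.

(** * Minimal idempotents and their eigenvalue property *)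

Definition idem q := [/\ biK q, star q = q & q *c q = q].

Definition nontriv q := exists x, q x != 0.

Lemma idem_at1 q : idem q -> q e = (nsq q)%:C.
Proof. by move=> [bq sq qq]; rewrite -ip_nsq (ip_conv Gs) sq qq. Qed.

(** From [q *c q = q] and [conv_bound], |q|^2 is pointwise at most [nsq q ^+ 2]; integrating gives
    [nsq q <= nsq q ^+ 2]. *)
Lemma idem_nsq_ge1 q : idem q -> nontriv q -> 1 <= nsq q.
Proof.
move=> [[cq _] sq qq] [x qx]; have n0 := nsq_gt0 hmu cq qx.
rewrite -(ler_pM2r n0) mul1r; apply: (nsq_le Gs) => // y.
by rewrite -{1}qq; exact: (conv_bound hmu).
Qed.

Lemma idem_sub q p : idem q -> idem p -> q *c p = p -> idem (fun x => q x - p x).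
Proof.
move=> [bq sq qq] [bp sp pp] qp; have [cq _] := bq; have [cp _] := bp.
have pq : p *c q = p by rewrite biK_convC.
split; first exact: biKB; first by rewrite star_sub sq sp.
have cqp : ctsC (fun x => q x - p x) by exact: ctsCB.
rewrite convBl// !convBr// qq pp qp pq; apply/funext => x.
by rewrite subrr subr0.
Qed.

Definition minimal q := [/\ idem q, nontriv q &
  forall p, idem p -> nontriv p -> q *c p = p -> p = q].

(** Descent on an integer bound for [nsq q]. A proper idempotent [p] below [q] splits off [q - p],
    and since squared norms are values at the identity, [nsq p] equals [nsq q] minus a number at
    least 1. *)
Lemma exists_minimal q : idem q -> nontriv q ->
  exists2 p, minimal p & q *c p = p.
Proof.
have [n] : exists n : nat, nsq q <= n%:R.
  by exists (Num.truncn (nsq q)).+1; rewrite ltW// truncnS_gt.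
elim: n q => [|n IH] q qn iq nq.
  by have := idem_nsq_ge1 iq nq; rewrite leNgt (le_lt_trans qn).
have [mq|nmq] := pselect (minimal q); first by exists q => //; case: iq.
have [p [ip np qp pq]] : exists p, [/\ idem p, nontriv p, q *c p = p & p <> q].
  apply/not_existsP => H; apply: nmq; split=> // p ip np qp.
  by have [//|pq] := pselect (p = q); case: (H p); split.
have [||//|r mr pr] := IH p.
  have isub := idem_sub iq ip qp.
  have nsub : nontriv (fun x => q x - p x).
    apply/not_existsP => H; apply: pq; apply/funext => x; apply/eqP.
    by rewrite eq_sym -subr_eq0; apply/negPn/negP/H.
  have := idem_nsq_ge1 isub nsub.
  have /(congr1 (@complex.Re R))/= := idem_at1 isub.
  rewrite raddfB/= (idem_at1 iq) (idem_at1 ip)/= => <-.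
  by rewrite -natr1 in qn; lra.
- by [].
exists r => //; have [[[cr _] _ _] _ _] := mr; have [[cq _] _ _] := iq.
by have [[cp _] _ _] := ip; rewrite -{1}pr -(convfA hmu)// qp.
Qed.

(** With [t = h *c q] nonzero, its top idempotent [p] satisfies [q *c p = p], because [p] is a
    multiple of [t *c t *c p] and [q] fixes [t]. Minimality forces [p = q], and the eigenvalue
    relation of [p] becomes one for [t *c t]. *)
Lemma minimal_square q h : minimal q -> biK h -> star h = h ->
  exists lam : R[i], (h *c q) *c (h *c q) = (fun x => lam * q x).
Proof.
move=> [iq nq qmin] bh sh; have [bq sq qq] := iq.
have [cq _] := bq; have [ch _] := bh.
set t := h *c q; have bt : biK t by exact: biK_conv.
have [ct _] := bt.
have qt : q *c t = t by rewrite (biK_convC bq bt) (convfA hmu)// qq.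
have tq : t *c q = t by rewrite (biK_convC bt bq).
have [[x tx]|nt] := pselect (nontriv t); last first.
  exists 0; apply/funext => x; rewrite mul0r /Defs.conv -[RHS](cint_cst mu).
  apply: cint_ext => y; rewrite (_ : t y = 0) ?mul0r//.
  by apply/eqP/negPn/negP => ty; apply: nt; exists y.
have st : star t = t by rewrite (star_conv hmu)// sh sq biK_convC.
have [|p [lam [[cp sp pp np] [lam0 ttp tr]]]] := top_idempotent hmu ct st.
  by exists x.
have bp : biK p.
  split=> // k l y Kk Kl; apply: tr => n.
  suff [_ H] : biK (convpow Gs mu t n) by exact: H.
  by elim: n => [//|n IH]; exact: biK_conv.
have lamC0 : lam%:C != 0 by rewrite fmorph_eq0 gt_eqF.
have ip : idem p by [].
have qp : q *c p = p.
  have ctt : ctsC (t *c t) by exact: ctsC_conv.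
  have := congr1 (Defs.conv Gs mu q) ttp; rewrite -(convfA hmu)// -(convfA hmu cq ct ct) qt ttp convZr// => H.
  by apply/funext => y; apply: (mulfI lamC0); exact: (esym (congr1 (fun f => f y) H)).
exists lam%:C; rewrite -{2}tq -(convfA hmu)//.
by rewrite -(qmin p ip np qp).
Qed.

(* Both t = h * q and t + q square to multiples of q, and
   (t + q)^2 = t^2 + 2 t + q. *)
Lemma minimal_eigen_sa q h : minimal q -> biK h -> star h = h ->
  exists c : R[i], h *c q = (fun x => c * q x).
Proof.
move=> mq bh sh; have [[bq sq qq] _ _] := mq.
have [cq _] := bq; have [ch _] := bh.
have [lam Hlam] := minimal_square mq bh sh.
have [|lam' Hlam'] := minimal_square mq (biKD bh bq).
  by rewrite star_add sh sq.
set t := h *c q in Hlam *.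
have bt : biK t by exact: biK_conv.
have [ct _] := bt.
have qt : q *c t = t by rewrite (biK_convC bq bt) (convfA hmu)// qq.
have tq : t *c q = t by rewrite (biK_convC bt bq).
have ctq : ctsC (fun x => t x + q x) by exact: ctsCD.
have E1 : (fun x => h x + q x) *c q = (fun x => t x + q x) by rewrite convDl// qq.
have E2 : (fun x => t x + q x) *c (fun x => t x + q x) =
    (fun x => (lam * q x + t x) + (t x + q x)).
  by rewrite convDl// convDr// (@convDr _ _ _ _ t q q)// Hlam qt tq qq.
exists ((lam' - lam - 1) / 2); apply/funext => x.
have := congr1 (fun f => f x) Hlam'; rewrite E1 E2 => H.
rewrite mulrAC; apply: (canRL (mulfK _)); first by rewrite pnatr_eq0.
by rewrite !mulrBl -H; ring.
Qed.

(** Cartesian decomposition: [h + star h] and ['i%C * (h - star h)] are both self-adjoint. *)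
Lemma minimal_eigen q h : minimal q -> biK h ->
  exists c : R[i], h *c q = (fun x => c * q x).
Proof.
move=> mq bh; have [[[cq _] _ _] _ _] := mq; have bsh := biK_star bh.
have [||a Ha] := @minimal_eigen_sa q (fun x => h x + star h x) mq.
- exact: biKD.
- by rewrite star_add starK; apply/funext => x; rewrite addrC.
have [||b Hb] := @minimal_eigen_sa q (fun x => 'i%C * (h x - star h x)) mq.
- by apply: biKZ; exact: biKB.
- rewrite star_scale star_sub starK; apply/funext => x.
  rewrite (_ : ('i%C)^* = - 'i%C); last by apply: eq_ReIm => //=; rewrite oppr0.
  by rewrite mulNr -mulrN opprB.
exists ((a - 'i%C * b) / 2); apply/funext => x.
have [ch _] := bh; have [csh _] := bsh.
have := congr1 (fun f => f x) Ha; rewrite convDl//= => Hax.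
have := congr1 (fun f => f x) Hb; rewrite convZl//; last exact: ctsCB.
rewrite convBl//= => Hbx.
have i2 : 'i%C * 'i%C = -1 :> R[i] by rewrite -expr2 sqr_i.
rewrite mulrAC; apply: (canRL (mulfK _)); first by rewrite pnatr_eq0.
rewrite mulrBl -Hax -mulrA -Hbx mulrA i2; ring.
Qed.

(** The defect [D] of the functional equation is itself bi-invariant in its free variable, so its
    conjugate acts on [phi] by a scalar [c]. At the identity this computes the integral of conj [D]
    against phi(y^-1); at [x], after averaging over [K], the integral against [Phi]. The two combine
    to make the squared norm of [D] zero. *)
Lemma spherical_of_eigen phi : biK phi -> phi e = 1 ->
  (forall h, biK h -> exists c : R[i], h *c phi = (fun x => c * phi x)) ->
  spherical Gs nu phi.
Proof.
move=> bphi phi1 eig; have [cphi _] := bphi; split=> // [|x' x]; first exact/contCP.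
pose Phi y := cint nu (fun k => phi (inv y *g k *g x)).
pose D y := Phi y - phi (inv y) * phi x.
have cPhi : ctsC Phi.
  apply: (ctsC_cint cG nu (F := fun z : G * G => phi (inv z.2 *g z.1 *g x))).
  apply: (ctsC_comp _ cphi); apply: mul_cts; last exact: cst_cts.
  by apply: mul_cts; [apply: inv_cts; exact: snd_cts|exact: fst_cts].
have cphiV : ctsC (fun y => phi (inv y)).
  by apply: (ctsC_comp _ cphi); apply: inv_cts; exact: id_cts.
have cD : ctsC D.
  by apply: ctsCB => //; apply: ctsCM => //; exact: ctsC_cst.
have bD : biK D.
  apply: biKI => // k y Kk; have Kk' := KV Kk.
    rewrite /D ginvM (biK_r _ bphi Kk'); congr (_ - _); rewrite /Phi.
    rewrite -[RHS](nu_transl (mulxky_cts (inv y) x cphi) Kk').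
    by apply: cint_ext => l; rewrite ginvM !gmulA.
  rewrite /D ginvM (biK_l _ bphi Kk'); congr (_ - _); rewrite /Phi.
  by apply: cint_ext => l; rewrite ginvM -!gmulA (biK_l _ bphi Kk').
have [c Hc] := eig _ (biKJ bD); have cDJ := ctsCJ cD.
have ce : c = I (fun y => (D y)^* * phi (inv y)).
  have := congr1 (fun f => f e) Hc; rewrite phi1 mulr1 => <-.
  by apply: cint_ext => y; rewrite gmulg1.
have cx : I (fun y => (D y)^* * Phi y) = c * phi x.
  by have := congr1 (fun f => f x) Hc; rewrite (conv_average x (biKJ bD) cphi).
suff D0 : D (inv x') = 0.
  by apply/eqP; rewrite -subr_eq0; apply/eqP; move: D0; rewrite /D /Phi ginvK.
apply: (ip_eq0 hmu) => //.
have -> : ip D D = I (fun y => (D y)^* * Phi y - phi x * ((D y)^* * phi (inv y))).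
  by apply: cint_ext => y; rewrite {1}/D; ring.
rewrite cintB ?cintZ ?cx -?ce 1?mulrC ?subrr//; apply: cts_bmeas.
- exact: ctsCM.
- exact: ctsCM.
- by apply: ctsC_scale; exact: ctsCM.
Qed.

(** Since [q] is a self-adjoint idempotent, q(x^-1 z) is the inner product of the translates of [q]
    by [x] and [z], so the form is a squared norm. *)
Lemma idem_pd q (n : nat) (y : 'I_n -> G) (c : 'I_n -> R[i]) : idem q ->
  0 <= \sum_(j < n) \sum_(l < n) q (inv (y j) *g y l) * c j * (c l)^*.
Proof.
move=> [[cq _] sq qq]; pose F z := \sum_(j < n) c j * q (inv (y j) *g z).
have qE x z : q (inv x *g z) = I (fun w => q (inv x *g w) * (q (inv z *g w))^*).
  rewrite -{1}qq conv_ip sq /ip.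
  rewrite -(haar_transl hmu (f := fun w => q (inv x *g w) * (q (inv z *g w))^*) x).
    by apply: cint_ext => w; rewrite gmulKg ginvM ginvK gmulA.
  by apply: ctsCM; [exact: ctsC_transl|apply: ctsCJ; exact: ctsC_transl].
suff -> : \sum_(j < n) \sum_(l < n) q (inv (y j) *g y l) * c j * (c l)^* = ip F F.
  exact: ip_ge0.
have cq' j : ctsC (fun w => q (inv (y j) *g w)) by exact: ctsC_transl.
rewrite /ip; under [RHS]cint_ext do rewrite mulr_suml.
rewrite cint_sum => [|j]; last first.
  by apply/cts_bmeas/ctsCM; [exact: ctsC_scale|apply: ctsCJ; apply: ctsC_sum => l; exact: ctsC_scale].
apply: eq_bigr => j _; under [RHS]cint_ext do rewrite rmorph_sum mulr_sumr.
rewrite cint_sum => [|l]; last first.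
  by apply/cts_bmeas/ctsCM; [exact: ctsC_scale|apply: ctsCJ; exact: ctsC_scale].
apply: eq_bigr => l _; rewrite qE -mulrA mulrC -cintZ; last first.
  by apply/cts_bmeas/ctsCM => //; exact: ctsCJ.
by apply: cint_ext => w; rewrite rmorphM/=; ring.
Qed.

Lemma minimal_Zset q : minimal q ->
  exists (phi : G -> R[i]) (c : R[i]),
    [/\ Zset Gs nu phi, c != 0 & q = (fun x => c * phi x)].
Proof.
move=> mq; have [iq nq _] := mq; have [bq sq qq] := iq; have [cq _] := bq.
have n0 : 0 < nsq q by have := idem_nsq_ge1 iq nq; exact: lt_le_trans.
have c0 : (nsq q)%:C != 0 by rewrite fmorph_eq0 gt_eqF.
pose phi x := (nsq q)^-1%:C * q x.
have qE : q = (fun x => (nsq q)%:C * phi x).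
  by apply/funext => x; rewrite /phi mulrA -rmorphM/= mulfV ?gt_eqF// mul1r.
have bphi : biK phi by exact: biKZ.
have [cphi _] := bphi.
exists phi, (nsq q)%:C; split => //; split; last first.
  apply: spherical_of_eigen => // [|h bh].
    by rewrite /phi (idem_at1 iq) -rmorphM/= mulVf ?gt_eqF.
  have [c Hc] := minimal_eigen mq bh; have [ch _] := bh.
  exists c; rewrite convZr// Hc; apply/funext => x.
  by rewrite /phi mulrCA.
split; first exact/contCP.
move=> n y c; have := idem_pd y c iq => H.
rewrite (_ : \sum_j _ = (nsq q)^-1%:C *
    \sum_(j < n) \sum_(l < n) q (inv (y j) *g y l) * c j * (c l)^*).
  by rewrite mulr_ge0// ler0c invr_ge0 ltW.
rewrite mulr_sumr; apply: eq_bigr => j _; rewrite mulr_sumr; apply: eq_bigr => l _.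
by rewrite /phi !mulrA.
Qed.

(** * Properties of positive definite spherical functions *)

Section Spherical.
Variables (phi : G -> R[i]) (Zphi : Zset Gs nu phi).

Lemma Z_cts : ctsC phi. Proof. by case: Zphi => [[/contCP]]. Qed.

Lemma Z_at1 : phi e = 1. Proof. by case: Zphi => _ []. Qed.

Lemma Z_pd : pd_kernel (fun x y : G => phi (inv x *g y)).
Proof. by case: Zphi => [[]]. Qed.

Lemma Z_spherical x y : cint nu (fun k => phi (x *g k *g y)) = phi x * phi y.
Proof. by case: Zphi => _ []. Qed.

Lemma Z_inv x : phi (inv x) = (phi x)^*.
Proof. by have := pd_herm Z_pd e x; rewrite ginv1 gmul1g gmulg1. Qed.

Lemma Z_star : star phi = phi.
Proof. by apply/funext => x; rewrite /star Z_inv conjCK. Qed.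

Lemma Z_le1 x : normc (phi x) <= 1.
Proof.
have := pd_normc Z_pd e x.
rewrite ginv1 !gmul1g gmulVg Z_at1 /= => H.
by rewrite -(ler_pM2l (ltr0n R 2)) mulr1.
Qed.

(** The functional equation at y = e writes [phi] as its own average over [K] on the right; left
    invariance follows through [Z_inv]. *)
Lemma Z_biK : biK phi.
Proof.
have Zr k x : K k -> phi (x *g k) = phi x.
  move=> Kk; have := Z_spherical x e; rewrite Z_at1 mulr1 => <-.
  rewrite -(nu_transl (mulxky_cts x e Z_cts) Kk).
  have := Z_spherical (x *g k) e; rewrite Z_at1 mulr1 => <-.
  by apply: cint_ext => l; rewrite !gmulA.
apply: biKI => [|k x Kk|k x Kk]; [exact: Z_cts| |exact: Zr].
rewrite -[k *g x](ginvK Gs) Z_inv ginvM Zr; last exact: KV.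
by rewrite Z_inv conjCK.
Qed.

(** Averaging replaces phi(y^-1 x) by phi(y^-1) phi(x) under the integral, so [phi] is a common
    eigenvector and the eigenvalue is the spherical transform of [h]. *)
Lemma conv_Z h : biK h -> h *c phi = (fun x => ip h phi * phi x).
Proof.
move=> bh; have [ch _] := bh; have cphi := Z_cts; apply/funext => x.
rewrite (conv_average x bh cphi) mulrC -cintZ; last exact/cts_bmeas/ip_cts.
by apply: cint_ext => y; rewrite Z_spherical Z_inv; ring.
Qed.

Lemma Z_nsq_gt0 : 0 < nsq phi.
Proof.
by apply: (nsq_gt0 hmu Z_cts (x := e)); rewrite Z_at1 oner_neq0.
Qed.

(** This is [phi *c phi = nsq phi * phi] up to translation; it is the source of both the Gram
    matrices and the trace computation for the dimension. *)
Lemma Z_reproducing x z :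
  I (fun y => phi (inv x *g y) * phi (inv y *g z)) = (nsq phi)%:C * phi (inv x *g z).
Proof.
have cphi := Z_cts; rewrite -ip_nsq.
have <- := congr1 (fun f => f (inv x *g z)) (conv_Z Z_biK).
rewrite /Defs.conv.
rewrite -(haar_transl hmu (f := fun y => phi (inv x *g y) * phi (inv y *g z)) x).
  by apply: cint_ext => y; rewrite gmulKg ginvM gmulA.
apply: ctsCM; first exact: ctsC_transl.
apply: (ctsC_comp _ cphi); apply: mul_cts; last exact: cst_cts.
by apply: inv_cts; exact: id_cts.
Qed.

End Spherical.

(** By commutativity [phi *c psi] is a multiple of both functions, and at the identity the two
    scalars agree. *)
Lemma Z_orthogonal phi psi : Zset Gs nu phi -> Zset Gs nu psi ->
  ip phi psi != 0 -> phi = psi.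
Proof.
move=> Zphi Zpsi; have bphi := Z_biK Zphi; have bpsi := Z_biK Zpsi.
have cphi := Z_cts Zphi; have cpsi := Z_cts Zpsi => n0.
have := biK_convC bphi bpsi; rewrite (conv_Z Zpsi bphi) (conv_Z Zphi bpsi) => H.
have := congr1 (fun f => f e) H; rewrite !Z_at1// !mulr1 => E.
apply/funext => x; apply: (mulfI n0); rewrite {1}E.
by have := congr1 (fun f => f x) H.
Qed.

(** If [r] is nonzero, so is the self-adjoint [s = star r *c r], whose value at the identity is a
    squared norm. Below its top idempotent lies a minimal [q], a multiple of some [phi] in [Zset].
    Orthogonality gives [r *c q = 0], hence [s *c q = 0], while [s *c s] acts on [q] by
    [lam > 0]. *)
Lemma Z_complete r : biK r -> (forall phi, Zset Gs nu phi -> ip r phi = 0) ->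
  forall x, r x = 0.
Proof.
move=> br Hr; apply: contrapT => /existsNP[x0 /eqP rx0].
have [cr _] := br; have csr := ctsC_star Gs cr.
pose s := star r *c r; have cs : ctsC s by exact: ctsC_conv.
have ss : star s = s by rewrite /s (star_conv hmu)// starK.
have se : s e != 0.
  rewrite /s -{2}[r](starK Gs) -(ip_conv Gs) ip_nsq fmorph_eq0 gt_eqF//.
  by apply: (nsq_gt0 hmu csr (x := inv x0)); rewrite /star ginvK fmorph_eq0.
have [|p [lam [[cp sp pp np] [lam0 ssp tr]]]] := top_idempotent hmu cs ss.
  by exists e.
have bs : biK s by apply: biK_conv => //; exact: biK_star.
have bp : biK p.
  split=> // k l y Kk Kl; apply: tr => n.
  suff [_ H] : biK (convpow Gs mu s n) by exact: H.
  by elim: n => [//|n IH]; exact: biK_conv.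
have [q mq pq] := exists_minimal (q := p) (And3 bp sp pp) np.
have [[[cq _] _ _] [x qx] _] := mq.
have [phi [c [Zphi c0 qE]]] := minimal_Zset mq.
have rq : r *c q = (fun=> 0).
  have cphi := Z_cts Zphi.
  rewrite qE convZr// (conv_Z Zphi br) Hr//; apply/funext => y.
  by rewrite mul0r mulr0.
have sq : s *c q = (fun=> 0).
  rewrite /s (convfA hmu)// rq; apply/funext => y.
  by rewrite /Defs.conv -[RHS](cint_cst mu); apply: cint_ext => z; rewrite mulr0.
have := congr1 (fun f => (f *c q) x) ssp.
have css : ctsC (s *c s) by exact: ctsC_conv.
rewrite (convfA hmu css cp cq) pq convZl// pq (convfA hmu)// sq.
rewrite [LHS](_ : _ = 0); last first.
  by rewrite /Defs.conv -[RHS](cint_cst mu); apply: cint_ext => z; rewrite mulr0.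
by move/esym/eqP; rewrite mulf_eq0 fmorph_eq0 gt_eqF//= (negbTE qx).
Qed.

(** * The dimension of the span of the translates *)

Section Dimension.
Variables (phi : G -> R[i]) (Zphi : Zset Gs nu phi).
Let cphi : ctsC phi := Z_cts Zphi.

Lemma ltransl_cts x : ctsC (ltransl Gs x phi).
Proof. exact: ctsC_transl. Qed.

Lemma ip_ltransl x z :
  ip (ltransl Gs x phi) (ltransl Gs z phi) = (nsq phi)%:C * phi (inv x *g z).
Proof.
rewrite -(Z_reproducing Zphi); apply: cint_ext => y.
by rewrite /ltransl -(Z_inv Zphi) ginvM ginvK.
Qed.

Let nsq0 : (nsq phi)%:C != 0.
Proof. by rewrite fmorph_eq0 gt_eqF ?Z_nsq_gt0. Qed.

Section Family.
Variables (m : nat) (g : 'I_m -> G).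
Hypothesis ind : lin_indep (fun i => ltransl Gs (g i) phi).
Let F i := ltransl Gs (g i) phi.
Let cF i : ctsC (F i) := ltransl_cts (g i).

Definition gram : 'M[R[i]]_m := \matrix_(i, j) phi (inv (g i) *g g j).

(** Up to the factor [nsq phi], [gram] is the Gram matrix of the translates [F i]; a null row gives
    a combination of norm zero. *)
Lemma gram_unit : gram \in unitmx.
Proof.
rewrite -row_free_unit; apply: inj_row_free => v vA.
pose H x := \sum_i v 0 i * F i x.
have cvF i : ctsC (fun x => v 0 i * F i x) by exact: ctsC_scale.
have cH : ctsC H by exact: ctsC_sum.
have HF j : ip H (F j) = 0.
  rewrite ip_suml//; under eq_bigr do rewrite ipZl// ip_ltransl mulrCA.
  rewrite -mulr_sumr (_ : \sum_i _ = (v *m gram) 0 j); first by rewrite vA mxE mulr0.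
  by rewrite mxE; apply: eq_bigr => i _; rewrite mxE.
have H0 : ip H H = 0.
  rewrite {1}/H ip_suml//; apply: big1 => i _.
  by rewrite ipZl// -ipJ// HF rmorph0 mulr0.
apply/rowP => i; rewrite [RHS]mxE; apply: (ind (c := fun i => v 0 i)) => x.
exact: (ip_eq0 hmu cH H0).
Qed.

(* The translate of phi by x minus its orthogonal projection to the span of
   the F i. *)
Definition defect x y := ltransl Gs x phi y -
  \sum_i (\sum_j phi (inv x *g g j) * invmx gram j i) * F i y.

Lemma defect_cts x : ctsC (defect x).
Proof.
apply: ctsCB; first exact: ltransl_cts.
by apply: ctsC_sum => i; exact: ctsC_scale.
Qed.

Lemma ip_defect x z : ip (defect x) (ltransl Gs z phi) = (nsq phi)%:C *
  (phi (inv x *g z) - \sum_i (\sum_j phi (inv x *g g j) * invmx gram j i) *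
     phi (inv (g i) *g z)).
Proof.
have cz := ltransl_cts z.
rewrite ipBl//; [|exact: ltransl_cts|by apply: ctsC_sum => i; exact: ctsC_scale].
rewrite ip_ltransl ip_suml// => [|i]; last exact: ctsC_scale.
rewrite mulrBr mulr_sumr; congr (_ - _); apply: eq_bigr => i _.
by rewrite ipZl// ip_ltransl mulrCA.
Qed.

Lemma ip_defectF x l : ip (defect x) (F l) = 0.
Proof.
rewrite ip_defect; apply/eqP; rewrite mulf_eq0 (negbTE nsq0)/= subr_eq0; apply/eqP.
pose r : 'rV[R[i]]_m := \row_j phi (inv x *g g j).
transitivity ((r *m invmx gram *m gram) 0 l).
  by rewrite mulmxKV ?gram_unit// mxE.
rewrite mxE; apply: eq_bigr => i _; rewrite !mxE; congr (_ * _).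
by apply: eq_bigr => j _; rewrite mxE.
Qed.

Lemma ip_defect_self x : ip (defect x) (defect x) = ip (defect x) (ltransl Gs x phi).
Proof.
have cd := defect_cts x; have cx := ltransl_cts x.
rewrite -(ipJ Gs mu cd cd) -(ipJ Gs mu cx cd); congr Num.conj.
rewrite {1}/defect ipBl//; last by apply: ctsC_sum => i; exact: ctsC_scale.
rewrite [X in _ - X](_ : _ = 0) ?subr0// ip_suml// => [|i]; last exact: ctsC_scale.
by rewrite big1// => i _; rewrite ipZl// -(ipJ Gs mu cd (cF i)) ip_defectF rmorph0 mulr0.
Qed.

(* The value at x of the reproducing kernel of the span of the F i, normalized so
   that the span of all translates of phi would give 1; its integral is
   m * |phi|^2, hence m |phi|^2 <= 1 with equality for a maximal family. *)
Definition filled x :=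
  \sum_i (\sum_j phi (inv x *g g j) * invmx gram j i) * phi (inv (g i) *g x).

Lemma filledE x :
  filled x = \sum_i \sum_j invmx gram j i * (phi (inv (g i) *g x) * phi (inv x *g g j)).
Proof.
apply: eq_bigr => i _; rewrite mulr_suml; apply: eq_bigr => j _.
by rewrite mulrAC mulrC; congr (_ * _); exact: mulrC.
Qed.

Lemma rep_cts i j : ctsC (fun x => phi (inv (g i) *g x) * phi (inv x *g g j)).
Proof.
apply: ctsCM; first exact: ctsC_transl.
apply: (ctsC_comp _ cphi); apply: mul_cts; last exact: cst_cts.
by apply: inv_cts; exact: id_cts.
Qed.

Lemma filled_cts : ctsC filled.
Proof.
rewrite (funext filledE); apply: ctsC_sum => i; apply: ctsC_sum => j.
by apply: ctsC_scale; exact: rep_cts.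
Qed.

(** A trace computation: [Z_reproducing] turns the double sum into [nsq phi] times the trace of
    [gram *m invmx gram]. *)
Lemma cint_filled : I filled = (m%:R * nsq phi)%:C.
Proof.
rewrite (cint_ext mu filledE) cint_sum => [|i]; last first.
  by apply/cts_bmeas/ctsC_sum => j; apply: ctsC_scale; exact: rep_cts.
transitivity (\sum_(i < m) (nsq phi)%:C); last first.
  by rewrite sumr_const card_ord mulr_natl rmorphMn.
apply: eq_bigr => i _; rewrite cint_sum => [|j]; last first.
  by apply/cts_bmeas/ctsC_scale; exact: rep_cts.
rewrite (eq_bigr (fun j => (nsq phi)%:C * (gram i j * invmx gram j i))) => [|j _]; last first.
  rewrite cintZ; last exact/cts_bmeas/rep_cts.
  by rewrite (Z_reproducing Zphi) mxE mulrC -mulrA.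
rewrite -mulr_sumr (_ : \sum_j _ = (gram *m invmx gram) i i); last by rewrite mxE.
by rewrite mulmxV ?gram_unit// mxE eqxx mulr1.
Qed.

(** [1 - filled x] is the squared norm of [defect x] divided by [nsq phi]. *)
Lemma filled_ge0 x : 0 <= 1 - filled x.
Proof.
have := ip_ge0 mu (defect x); rewrite ip_defect_self ip_defect gmulVg (Z_at1 Zphi).
by rewrite pmulr_rge0// ltcR Z_nsq_gt0.
Qed.

Lemma indep_bound : m%:R * nsq phi <= 1.
Proof.
have := cint_ge0 mu filled_ge0; rewrite cintB; last 2 first.
- exact: bmeas_cst.
- exact/cts_bmeas/filled_cts.
by rewrite cint_cst cint_filled subr_ge0 => H; rewrite -lecR; exact: H.
Qed.

Lemma indep_maximal :
  (forall g' : 'I_m.+1 -> G, ~ lin_indep (fun i => ltransl Gs (g' i) phi)) ->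
  m%:R * nsq phi = 1.
Proof.
move=> dep; apply: complexI; rewrite -cint_filled rmorph1 -[RHS](cint_cst mu).
apply: cint_ext => x.
suff : ip (defect x) (ltransl Gs x phi) = 0.
  rewrite ip_defect gmulVg (Z_at1 Zphi) => /eqP.
  by rewrite mulf_eq0 (negbTE nsq0)/= subr_eq0 eq_sym => /eqP.
pose g' (i : 'I_m.+1) := if unlift ord0 i is Some j then g j else x.
have := dep g'; rewrite /lin_indep => /existsNP[c /not_implyP[c0 /existsNP[i0 ci0]]].
have E y : c ord0 * ltransl Gs x phi y + \sum_i c (lift ord0 i) * F i y = 0.
  rewrite -[RHS](c0 y) big_ord_recl /g' unlift_none; congr (_ + _).
  by apply: eq_bigr => i _; rewrite liftK.
(* Otherwise the relation would involve only the independent [F i]. Hence the translate by [x] lies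
   in their span, to which the defect is orthogonal. *)
have c00 : c ord0 != 0.
  apply/eqP => c00; apply: ci0.
  have cl : forall i, c (lift ord0 i) = 0.
    apply: ind => y; have := E y; by rewrite c00 mul0r add0r.
  by case: (unliftP ord0 i0) => [j ->|->].
have Lx : ltransl Gs x phi = (fun y => \sum_i (- (c ord0)^-1 * c (lift ord0 i)) * F i y).
  apply/funext => y; apply: (mulfI c00); rewrite mulr_sumr.
  have := E y => /eqP; rewrite addr_eq0 => /eqP ->; rewrite -sumrN.
  by apply: eq_bigr => i _; rewrite !mulrA mulrN divff// mulN1r mulNr.
have cd := defect_cts x; have cx := ltransl_cts x.
rewrite -(ipJ Gs mu cx cd) {1}Lx ip_suml// => [|i]; last exact: ctsC_scale.
rewrite big1 ?rmorph0// => i _.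
by rewrite ipZl// -(ipJ Gs mu cd (cF i)) ip_defectF rmorph0 mulr0.
Qed.

End Family.

Lemma Z_span_dim : exists n : nat, span_dim Gs phi n /\ n%:R * nsq phi = 1.
Proof.
pose P m := `[< exists g : 'I_m -> G, lin_indep (fun i => ltransl Gs (g i) phi) >].
have P0 : exists m, P m.
  by exists 0%N; apply/asboolP; exists (fun=> e) => c _ [].
have Pb m : P m -> (m <= Num.truncn (nsq phi)^-1)%N.
  move=> /asboolP[g /indep_bound].
  rewrite -ler_pdivlMr ?Z_nsq_gt0// mul1r => H.
  by rewrite -ltnS -(ltr_nat R) (le_lt_trans H)// truncnS_gt.
case: (ex_maxnP P0 Pb) => n /asboolP[g gind] nmax.
exists n; split; last first.
  apply: (indep_maximal gind) => g' g'ind.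
  by have := nmax n.+1; rewrite ltnn => H; suff: false by []; apply: H; apply/asboolP; exists g'.
split; first by exists g.
by move=> m g' g'ind; apply: nmax; apply/asboolP; exists g'.
Qed.

End Dimension.

(** * Orthogonal sums and Bessel's inequality *)

Lemma sum_orthogonal (t : (G -> R[i]) -> R[i]) l phi : fin_sub (Zset Gs nu) l ->
  Zset Gs nu phi -> List.In phi l ->
  \sum_(psi <- l) t psi * ip psi phi = t phi * (nsq phi)%:C.
Proof.
move=> [nl Zl] Zphi.
have zero l' : (forall i, List.In i l' -> Zset Gs nu i) -> ~ List.In phi l' ->
    \sum_(psi <- l') t psi * ip psi phi = 0.
  elim: l' => [|psi l' IH] Zl' nin; first by rewrite big_nil.
  rewrite big_cons IH ?addr0; last 2 first.
  - by move=> i il; apply: Zl'; right.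
  - by move=> il; apply: nin; right.
  have [->|n0] := eqVneq (ip psi phi) 0; first by rewrite mulr0.
  case: nin; left; apply: Z_orthogonal n0 => //.
  by apply: Zl'; left.
elim: l nl Zl => [//|psi l IH] nl Zl /=; inversion nl; subst.
rewrite big_cons => -[psiE|il].
  by rewrite -psiE in zero *; rewrite zero ?addr0 ?ip_nsq// => i il; apply: Zl; right.
rewrite IH//; last by move=> i il'; apply: Zl; right.
have [->|n0] := eqVneq (ip psi phi) 0; first by rewrite mulr0 add0r.
have E : psi = phi by apply: Z_orthogonal n0 => //; apply: Zl; left.
by subst psi.
Qed.

Lemma ctsC_sum_In (T : Type) (l : seq T) (F : T -> G -> R[i]) :
  (forall i, List.In i l -> ctsC (F i)) -> ctsC (fun x => \sum_(i <- l) F i x).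
Proof.
elim: l => [|i l IH] H; first by under eq_fun do rewrite big_nil; exact: ctsC_cst.
under eq_fun do rewrite big_cons; apply: ctsCD; first by apply: H; left.
by apply: IH => j jl; apply: H; right.
Qed.

Lemma ip_suml_In (T : Type) (l : seq T) (F : T -> G -> R[i]) g :
  (forall i, List.In i l -> ctsC (F i)) -> ctsC g ->
  ip (fun x => \sum_(i <- l) F i x) g = \sum_(i <- l) ip (F i) g.
Proof.
move=> + cg; elim: l => [|i l IH] H.
  rewrite big_nil /ip -[RHS](cint_cst mu).
  by apply: cint_ext => x; rewrite big_nil mul0r.
rewrite big_cons -IH; last by move=> j jl; apply: H; right.
rewrite -ipDl//; last 2 first.
- by apply: H; left.
- by apply: ctsC_sum_In => j jl; apply: H; right.
by apply: cint_ext => x; rewrite big_cons.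
Qed.

Section PositiveDefiniteFunction.
Variables (h : G -> R[i]) (ch : ctsC h).
Hypothesis hpd : pd_kernel (fun x y : G => h (inv x *g y)).

Lemma pd_inv x : h (inv x) = (h x)^*.
Proof. by have := pd_herm hpd e x; rewrite ginv1 gmul1g gmulg1. Qed.

Lemma pd_star : star h = h.
Proof. by apply/funext => x; rewrite /star pd_inv conjCK. Qed.

(* Integrated form of positive definiteness, tested against the measure
   c * dirac_e + F * mu; it is the limit of the finite forms at the nodes of a
   quadrature. *)
Lemma pd_integral f (c : R[i]) : ctsC f ->
  0 <= complex.Re (c * c^* * h e + (c * ip h f + (c * ip h f)^*) + ip (f *c h) f).
Proof.
move=> cf; apply/ler_addgt0Pr => eps eps0.
set X := _ + ip (f *c h) f.
have c0 := normc_ge0 c.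
(* The two linear terms each cost [normc c * (2 * d)]; the quadratic term costs [2 * (2 * d)] for
   the outer quadrature and [2 * d] for the inner one. *)
pose d := eps / (4 * normc c + 6).
have D0 : 0 < 4 * normc c + 6 by rewrite ltr_wpDl ?mulr_ge0.
have d0 : 0 < d by rewrite divr_gt0.
pose g1 x := h x * (f x)^*.
have cg1 : ctsC g1 by exact: ip_cts.
pose k x y := f x * h (inv x *g y) * (f y)^*.
have ck : ctsC (fun z : G * G => k z.1 z.2).
  apply: ctsCM; first exact: conv_integrand_cts.
  by apply: ctsCJ; exact: (ctsC_comp (@snd_cts _ _) cf).
have cks := ctsC_comp (@swap_cts G) ck.
have ckx x : ctsC (fun y => k y x) by exact: (ctsC_comp (@pair_cts G x) cks).
have kJ x y : k y x = (k x y)^*.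
  have := pd_herm hpd x y; rewrite /k !rmorphM/= conjCK => <-.
  by rewrite mulrC mulrA mulrAC.
pose kap y := (f *c h) y * (f y)^*.
have kapE y : kap y = I (fun x => k x y).
  rewrite /kap mulrC /Defs.conv -cintZ; last exact/cts_bmeas/conv_section_cts.
  by apply: cint_ext => x; rewrite mulrC.
have ckap : ctsC kap by apply: ip_cts => //; exact: ctsC_conv.
(* Closeness is chosen so that the same nodes serve [g1], the iterated integral [kap] and every
   section of [k]. *)
have [|n [w [p [w0 w1 Q]]]] := @quadrature R G cG mu
    (fun x x' => normc (g1 x' - g1 x) <= d /\ forall y, normc (k x' y - k x y) <= d).
  move=> x; have H1 := ctsC_near x cg1 d0.
  by have H2 := tube cG x cks d0; near=> x'; split; near: x'.
have kapQ x x' : normc (g1 x' - g1 x) <= d /\ (forall y, normc (k x' y - k x y) <= d) ->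
    normc (kap x' - kap x) <= 2 * d.
  move=> [_ H]; rewrite !kapE; apply: (cint_bound cG) => // y.
  by rewrite (kJ x') (kJ x) -rmorphB normc_conj.
have Q1 := Q g1 d (cts_bmeas cg1) (fun x x' H => H.1).
have Q2 := Q kap (2 * d) (cts_bmeas ckap) kapQ.
have Q3 l : normc (kap (p l) - \sum_j (w j)%:C * k (p j) (p l)) <= 2 * d.
  by rewrite kapE; apply: Q => [|x x' [_ H]]; [exact: cts_bmeas|exact: H].
pose S1 := \sum_i (w i)%:C * g1 (p i).
pose S2 := \sum_l (w l)%:C * \sum_j (w j)%:C * k (p j) (p l).
pose S := c * c^* * h e + (c * S1 + (c * S1)^*) + S2.
have S0 : 0 <= S.
  (* The discrete form has mass [c] at the identity and mass [w j * f (p j)] at each node. *)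
  have := pd_extend hpd e c p (fun j => (w j)%:C * f (p j)).
  congr (0 <= _); rewrite /S gmulVg -!addrA; congr (_ + _).
    by rewrite [RHS]mulrC mulrA.
  rewrite [c * S1]mulr_sumr rmorph_sum; congr (_ + (_ + _)).
  - apply: eq_bigr => i _; rewrite ginv1 gmul1g rmorphM/= conj_real /g1.
    by rewrite mulrA [h _ * c]mulrC -!mulrA; congr (_ * _); rewrite mulrCA.
  - apply: eq_bigr => i _; rewrite gmulg1 pd_inv /g1 !rmorphM/= conj_real conjCK.
    by rewrite mulrC; congr (_ * _); rewrite mulrCA mulrA mulrC mulrA mulrAC.
  rewrite exchange_big/=; apply: eq_bigr => l _; rewrite mulr_sumr.
  apply: eq_bigr => j _; rewrite rmorphM/= conj_real /k.
  by ring.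
have XS : normc (X - S) <= eps.
  have -> : X - S = (c * (ip h f - S1) + (c * (ip h f - S1))^*) + (ip (f *c h) f - S2).
    by rewrite /X /S mulrBr rmorphB/=; ring.
  have -> : eps = (normc c * (2 * d) + normc c * (2 * d)) + (2 * (2 * d) + 2 * d).
    by rewrite /d; field; rewrite gt_eqF.
  apply: le_trans (le_normcD _ _) _; apply: lerD.
    apply: le_trans (le_normcD _ _) _.
    by rewrite normc_conj normcM lerD// ler_wpM2l.
  have -> : ip (f *c h) f - S2 = (ip (f *c h) f - \sum_l (w l)%:C * kap (p l)) +
      (\sum_l (w l)%:C * kap (p l) - S2) by rewrite addrA subrK.
  apply: le_trans (le_normcD _ _) _; apply: lerD; first exact: Q2.
  rewrite /S2 -sumrB; apply: le_trans (normc_sum _ _) _.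
  have -> : 2 * d = \sum_l w l * (2 * d) by rewrite -mulr_suml w1 mul1r.
  apply: ler_sum => l _.
  rewrite -mulrBr normcM normc_real ger0_norm//.
  by apply: ler_wpM2l; [exact: w0|exact: Q3].
have := le_trans (Re_le_normc _) XS; rewrite ler_norml => /andP[+ _].
move: S0; rewrite lecE => /andP[_] /=.
have -> : complex.Re (X - S) = complex.Re X - complex.Re S by rewrite raddfB.
by lra.
Unshelve. all: by end_near. Qed.

Hypothesis bh : biK h.

Lemma ip_pd_Z_real phi : Zset Gs nu phi -> (ip h phi)^* = ip h phi.
Proof.
move=> Zphi; have bphi := Z_biK Zphi; have [cphi _] := bphi.
rewrite (ipJ Gs mu ch cphi) (ip_conv Gs) pd_star (biK_convC bphi bh).
by rewrite (ip_conv Gs) (Z_star Zphi).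
Qed.

(** With [c = 0] and [f = phi], the integrated form reads [ip h phi * nsq phi], because [phi *c h]
    is a multiple of [phi]. *)
Lemma ip_pd_Z_ge0 phi : Zset Gs nu phi -> 0 <= ip h phi.
Proof.
move=> Zphi; have bphi := Z_biK Zphi; have [cphi _] := bphi.
have := pd_integral 0 cphi; rewrite !mul0r rmorph0 !add0r (biK_convC bphi bh).
rewrite (conv_Z Zphi bh) ipZl// ip_nsq.
have := ip_pd_Z_real Zphi; case: (ip h phi) => a b [/eqP]/=.
rewrite mulr0 subr0 lecE /= => ab; rewrite pmulr_lge0 ?Z_nsq_gt0// => ->.
by rewrite andbT; move/eqP : ab => ab; apply/eqP; lra.
Qed.

(** The test measure is [q] times [mu] minus the point mass at the identity, where [q] represents
    evaluation at the identity on the span of [l]. With S the sum on the left, both the cross term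
    and the quadratic term reduce to S, leaving h(e) - 2 S + S >= 0. *)
Lemma bessel_pd l : fin_sub (Zset Gs nu) l ->
  \sum_(phi <- l) (nsq phi)^-1%:C * ip h phi <= h e.
Proof.
move=> fl; have [nl Zl] := fl.
pose t (phi : G -> R[i]) : R[i] := (nsq phi)^-1%:C.
pose b phi := t phi * ip h phi.
pose q x := \sum_(phi <- l) t phi * phi x.
have tK phi : List.In phi l -> t phi * (nsq phi)%:C = 1.
  by move=> /Zl Zphi; rewrite -rmorphM/= mulVf// gt_eqF ?Z_nsq_gt0.
have ctphi phi : List.In phi l -> ctsC (fun x => t phi * phi x).
  by move=> /Zl Zphi; apply: ctsC_scale; exact: Z_cts.
have cq : ctsC q by exact: ctsC_sum_In.
have bq : biK q.
  split=> // k x y Kk Kx; apply: eq_big_In => phi /Zl Zphi.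
  by have [_ ->] := Z_biK Zphi.
have ipqphi phi : List.In phi l -> ip q phi = 1.
  move=> il; rewrite ip_suml_In//; last exact: Z_cts (Zl _ il).
  rewrite (eq_big_In (H := fun psi => t psi * ip psi phi)); last first.
    by move=> psi /Zl Zpsi; rewrite ipZl//; [exact: Z_cts|exact: Z_cts (Zl _ il)].
  by rewrite sum_orthogonal// ?tK//; exact: Zl.
have bJ phi : List.In phi l -> (b phi)^* = b phi.
  by move=> /Zl Zphi; rewrite /b rmorphM/= conj_real ip_pd_Z_real.
have ipqh : ip q h = \sum_(phi <- l) b phi.
  rewrite ip_suml_In//; apply: eq_big_In => phi il; have Zphi := Zl _ il.
  by rewrite ipZl//; [rewrite -(ipJ Gs mu ch (Z_cts Zphi)) ip_pd_Z_real|exact: Z_cts].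
have SJ : (\sum_(phi <- l) b phi)^* = \sum_(phi <- l) b phi.
  by rewrite rmorph_sum; exact: eq_big_In.
have hq : q *c h = (fun x => \sum_(phi <- l) b phi * phi x).
  rewrite (biK_convC bq bh); apply/funext => x; rewrite conv_ip.
  have csq : ctsC (fun y => star q (inv x *g y)).
    by apply: ctsC_transl; exact: ctsC_star.
  rewrite -(ipJ Gs mu csq ch) (_ : (fun y => star q _) =
    (fun y => \sum_(phi <- l) t phi * phi (inv x *g y))); last first.
    apply/funext => y; rewrite /star rmorph_sum; apply: eq_big_In => phi /Zl Zphi.
    by rewrite rmorphM/= conj_real (Z_inv Zphi) conjCK.
  rewrite ip_suml_In//; last first.
    by move=> phi il; apply: (@ctsC_transl R G Gs (fun y => t phi * phi y)); exact: ctphi.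
  rewrite rmorph_sum; apply: eq_big_In => phi il; have Zphi := Zl _ il.
  have cphi := Z_cts Zphi.
  rewrite ipZl//; last exact: ctsC_transl.
  rewrite rmorphM/= conj_real (ipJ Gs mu _ ch); last exact: ctsC_transl.
  rewrite -mulrA; congr (_ * _).
  have <- := congr1 (fun f => f x) (conv_Z Zphi bh).
  by rewrite conv_ip (Z_star Zphi).
have ipqhq : ip (q *c h) q = \sum_(phi <- l) b phi.
  rewrite hq ip_suml_In//; last first.
    by move=> phi il; apply: ctsC_scale; exact: Z_cts (Zl _ il).
  apply: eq_big_In => phi il; have cphi := Z_cts (Zl _ il).
  by rewrite ipZl// -(ipJ Gs mu cq cphi) ipqphi// rmorph1 mulr1.
have := pd_integral (-1) cq; rewrite ipqhq -(ipJ Gs mu cq ch) ipqh SJ.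
rewrite rmorphM/= SJ rmorphN1.
have := ger0_Im (pd_diag hpd e); rewrite gmulVg.
have /(congr1 (@complex.Im R)) := SJ; rewrite Im_conjc.
suff : forall z w : R[i], - complex.Im z = complex.Im z -> complex.Im w = 0 ->
    0 <= complex.Re (-1 * -1 * w + (-1 * z + -1 * z) + z) -> z <= w by exact.
move=> [a1 b1] [a2 b2] /= H1 H2 H3.
by rewrite lecE /= H2; apply/andP; split; [apply/eqP|]; move: H1 H3; lra.
Qed.

End PositiveDefiniteFunction.

(** * Spherical expansion *)

Section Expansion.
Variables (X : Type) (f : G -> X -> X -> R[i]).
Local Notation Z := (Zset Gs nu).

Lemma ip_ucvg (u : nat -> G -> R[i]) s g : (forall n, ctsC (u n)) -> ctsC s -> ctsC g ->
  ucvg u s -> cvgC (fun n => ip (u n) g) (ip s g).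
Proof.
move=> cu cs cg us eps eps0; have [M M0 gM] := ctsC_bounded cG cg.
have d0 : 0 < eps / (2 * M) by rewrite divr_gt0// mulr_gt0.
have [N HN] := us _ d0; exists N => n Nn.
have -> : eps = 2 * (eps / (2 * M) * M) by field; rewrite gt_eqF.
apply: (cint_bound cG) => [||x]; [exact: ip_cts|exact: ip_cts|].
by rewrite -mulrBl normcM normc_conj ler_pM ?normc_ge0// HN.
Qed.

(** Along finite sets that contain [phi], orthogonality makes the inner product of every partial sum
    with [phi] equal to the claimed value, so its limit is immediate. *)
Lemma Z_coefficient (t : (G -> R[i]) -> R[i]) s phi : ctsC s -> Z phi ->
  unif_sum Z (fun psi x => t psi * psi x) s -> ip s phi = t phi * (nsq phi)%:C.
Proof.
move=> cs Zphi us.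
have [l [fl ul]] := unif_sum_ucvg us (fin_sub_seq1 Zphi).
have ct psi : Z psi -> ctsC (fun x => t psi * psi x).
  by move=> Zpsi; apply: ctsC_scale; exact: Z_cts.
have cu n : ctsC (fun x => \sum_(psi <- l n) t psi * psi x).
  apply: (@ctsC_sum_In _ (l n) (fun psi x => t psi * psi x)) => psi il.
  by apply: ct; exact: (fl n).1.2 psi il.
apply: cvgC_unique (ip_ucvg cu cs (Z_cts Zphi) ul) _.
rewrite -[X in cvgC X _](_ : (fun=> t phi * (nsq phi)%:C) = _); first exact: cvgC_cst.
apply/funext => n; rewrite ip_suml_In//; [|by move=> psi /((fl n).1.2 psi)/ct|exact: Z_cts].
rewrite -(sum_orthogonal t (fl n).1 Zphi); last by apply: (fl n).2; left.
apply: eq_big_In => psi /((fl n).1.2 psi) Zpsi.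
by rewrite ipZl//; exact: Z_cts.
Qed.

Lemma unif_sum_cts (t : (G -> R[i]) -> R[i]) s :
  unif_sum Z (fun psi x => t psi * psi x) s -> ctsC s.
Proof.
move=> us; have [l [fl ul]] := unif_sum_ucvg us (fin_sub_nil Z).
apply: (ucvg_cts ul) => n.
apply: (@ctsC_sum_In _ (l n) (fun psi x => t psi * psi x)) => psi il.
by apply: ctsC_scale; apply: Z_cts; exact: (fl n).1.2 psi il.
Qed.

Lemma has_sum_invariant (t : (G -> R[i]) -> R[i]) s :
  (forall x, has_sum Z (fun psi => t psi * psi x) (s x)) -> bi_invariant Gs K s.
Proof.
move=> hs k l x Kk Kl; apply: has_sum_unique (hs _) _.
apply: has_sum_ext (hs x) => psi Zpsi.
by have [_ ->] := Z_biK Zpsi.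
Qed.

Section Kernels.
Variable B : (G -> R[i]) -> X -> X -> R[i].
Hypothesis Bpd : forall phi, Z phi -> pd_kernel (B phi).
Hypothesis Bfin : forall u, finite_sum Z (fun phi => B phi u u).

(** Since |phi| <= 1, [pd_normc] bounds each term by B(phi)(u,u) + B(phi)(v,v), uniformly in [x]. *)
Lemma kernel_dominated u v : exists (D : (G -> R[i]) -> R) (M : R),
  (forall l, fin_sub Z l -> \sum_(phi <- l) D phi <= M) /\
  (forall phi x, Z phi -> normc (B phi u v * phi x) <= D phi).
Proof.
have [M HM] := Bfin u; have [N HN] := Bfin v.
have Re_ge0 phi w : Z phi -> 0 <= complex.Re (B phi w w).
  by move=> /Bpd Zphi; have := pd_diag Zphi w; rewrite lecE => /andP[].
have bound w L l : \sum_(i <- l) B i w w <= L%:C -> \sum_(i <- l) complex.Re (B i w w) <= L.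
  by rewrite lecE => /andP[_]; rewrite Re_sum.
exists (fun phi => complex.Re (B phi u u) + complex.Re (B phi v v)), (M + N).
split=> [l fl|phi x Zphi].
- by rewrite big_split lerD//; [exact/bound/HM|exact/bound/HN].
- have H := pd_normc (Bpd Zphi) u v.
  have := Z_le1 Zphi x; have := normc_ge0 (B phi u v); rewrite normcM => H0 H1.
  have := Re_ge0 phi u Zphi; have := Re_ge0 phi v Zphi.
  by have := ler_piMr H0 H1; move: H; lra.
Qed.

Lemma kernel_unif_sum u v s :
  (forall x, has_sum Z (fun phi => B phi u v * phi x) (s x)) ->
  unif_sum Z (fun phi x => B phi u v * phi x) s.
Proof.
have [D [M [DM aD]]] := kernel_dominated u v.
exact: (dominated_has_sum DM aD).
Qed.

(** A Schur product argument: phi(x^-1 y) is, up to [nsq phi], an inner product of translates, so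
    the form is an integral over [z] of forms of [B phi] with coefficients [F i z]. *)
Lemma kernel_product_pd phi : Z phi ->
  pd_kernel (fun p q : G * X => B phi p.2 q.2 * phi (inv p.1 *g q.1)).
Proof.
move=> Zphi n y c; have cphi := Z_cts Zphi.
have n0 := Z_nsq_gt0 Zphi.
pose F i z := c i * phi (inv (y i).1 *g z).
have cF i : ctsC (F i) by apply: ctsC_scale; exact: ctsC_transl.
have FE j l : B phi (y j).2 (y l).2 * phi (inv (y j).1 *g (y l).1) * c j * (c l)^* =
    (nsq phi)^-1%:C * (B phi (y j).2 (y l).2 * ip (F j) (F l)).
  rewrite /F ipZl//; [|exact: ctsC_transl|exact: cF].
  rewrite ipZr//; try exact: ctsC_transl.
  have := ip_ltransl Zphi (y j).1 (y l).1; rewrite /ltransl => ->.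
  have nK : (nsq phi)^-1%:C * (nsq phi)%:C = 1 by rewrite -rmorphM/= mulVf ?gt_eqF.
  by rewrite -[LHS]mul1r -nK; ring.
have cBF j l : ctsC (fun z => B phi (y j).2 (y l).2 * (F j z * (F l z)^*)).
  by apply: ctsC_scale; exact: ip_cts.
rewrite (_ : \sum_j _ = (nsq phi)^-1%:C * I (fun z => \sum_j \sum_l
    B phi (y j).2 (y l).2 * (F j z * (F l z)^*))).
  rewrite mulr_ge0 ?ler0c ?invr_ge0 ?(ltW n0)//; apply: cint_ge0 => z.
  have := Bpd Zphi (fun i => (y i).2) (fun i => F i z).
  by under eq_bigr do under eq_bigr do rewrite -mulrA.
rewrite cint_sum => [|j]; last by apply/cts_bmeas/ctsC_sum.
rewrite mulr_sumr; apply: eq_bigr => j _; rewrite cint_sum => [|l]; last exact: cts_bmeas.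
rewrite mulr_sumr; apply: eq_bigr => l _; rewrite FE; congr (_ * _).
by rewrite cintZ//; exact/cts_bmeas/ip_cts.
Qed.

Lemma series_Psharp : (forall x u v, has_sum Z (fun phi => B phi u v * phi x) (f x u v)) ->
  Psharp Gs K f.
Proof.
move=> hs; split=> [u v|u v|n y c].
- by apply: (has_sum_invariant (t := fun phi => B phi u v)) => x.
- by apply/contCP/unif_sum_cts/kernel_unif_sum => x; exact: hs.
- apply: (@has_sum_ge0 R _ Z (fun phi => \sum_(j < n) \sum_(l < n)
    B phi (y j).2 (y l).2 * phi (inv (y j).1 *g (y l).1) * c j * (c l)^*)).
    by move=> phi Zphi; exact: kernel_product_pd.
  apply: has_sum_sum => j; apply: has_sum_sum => l.
  have := has_sumZ (c j * (c l)^*) (hs (inv (y j).1 *g (y l).1) (y j).2 (y l).2).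
  rewrite [_ * f _ _ _]mulrC -mulrA; apply: has_sum_ext => phi _.
  by rewrite [LHS]mulrC !mulrA.
Qed.

Lemma series_coefficient phi u v : Z phi ->
  (forall x u v, has_sum Z (fun phi => B phi u v * phi x) (f x u v)) ->
  ip (fun x => f x u v) phi = B phi u v * (nsq phi)%:C.
Proof.
move=> Zphi hs; have us := kernel_unif_sum (fun x => hs x u v).
exact: (Z_coefficient (t := fun phi => B phi u v) (unif_sum_cts us) Zphi us).
Qed.

End Kernels.

Hypothesis Pf : Psharp Gs K f.

Lemma Psharp_biK u v : biK (fun x => f x u v).
Proof. by case: Pf => fK fc _; split=> //; exact/contCP. Qed.

(** By [Z_span_dim] the factor [(nsq phi)^-1] is the dimension delta(phi). *)
Definition coef phi u v : R[i] := (nsq phi)^-1%:C * ip (fun x => f x u v) phi.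

(** For fixed points and coefficients on [X], the combination [h] is a positive definite function on
    the group, as the kernel of [f] shows when tested on product families. The form is then
    [ip h phi] up to a positive factor. *)
Lemma coef_pd phi : Z phi -> pd_kernel (coef phi).
Proof.
move=> Zphi n u c; have cphi := Z_cts Zphi; have [_ _ fpd] := Pf.
pose h x := \sum_(j < n) \sum_(l < n) c j * (c l)^* * f x (u j) (u l).
have cf j l : ctsC (fun x => c j * (c l)^* * f x (u j) (u l)).
  by apply: ctsC_scale; have [] := Psharp_biK (u j) (u l).
have ch : ctsC h by apply: ctsC_sum => j; exact: ctsC_sum.
have bh : biK h.
  split=> // k l x Kk Kl; apply: eq_bigr => i _; apply: eq_bigr => j _.
  by have [_ ->] := Psharp_biK (u i) (u j).
have hpd : pd_kernel (fun x y : G => h (inv x *g y)).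
  move=> m y d.
  have := pd_fin fpd (fun ij : 'I_m * 'I_n => (y ij.1, u ij.2)) (fun ij => d ij.1 * c ij.2).
  congr (0 <= _); rewrite -(pair_bigA _ (fun a i => \sum_(p : 'I_m * 'I_n)
    f (inv (y a) *g y p.1) (u i) (u p.2) * (d a * c i) * (d p.1 * c p.2)^*))/=.
  apply: eq_bigr => a _.
  under eq_bigr => i _ do rewrite -(pair_bigA _ (fun b j =>
    f (inv (y a) *g y b) (u i) (u j) * (d a * c i) * (d b * c j)^*))/=.
  rewrite exchange_big/=; apply: eq_bigr => b _; rewrite -mulrA mulr_suml.
  apply: eq_bigr => i _; rewrite mulr_suml; apply: eq_bigr => j _.
  by rewrite rmorphM/=; ring.
have -> : \sum_j \sum_l coef phi (u j) (u l) * c j * (c l)^* = (nsq phi)^-1%:C * ip h phi.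
  rewrite ip_suml// => [|j]; last exact: ctsC_sum.
  rewrite mulr_sumr; apply: eq_bigr => j _; rewrite ip_suml//.
  rewrite mulr_sumr; apply: eq_bigr => l _.
  rewrite ipZl//; last by have [] := Psharp_biK (u j) (u l).
  by rewrite /coef -!mulrA; congr (_ * _); rewrite mulrC -mulrA.
by rewrite mulr_ge0 ?ip_pd_Z_ge0// ler0c invr_ge0 ltW// Z_nsq_gt0.
Qed.

Lemma coef_finite_sum u : finite_sum Z (fun phi => coef phi u u).
Proof.
have [_ _ fpd] := Pf; have bf := Psharp_biK u u.
have hpd : pd_kernel (fun x y : G => f (inv x *g y) u u).
  by move=> n y c; exact: (fpd n (fun i => (y i, u)) c).
exists (complex.Re (f e u u)) => l fl.
have := bessel_pd bf.1 hpd bf fl.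
have := ger0_Im (pd_diag hpd e); rewrite gmulVg => im0.
by rewrite [f e u u]complexE im0 mulr0 addr0.
Qed.

Lemma coef_has_sum x u v : has_sum Z (fun phi => coef phi u v * phi x) (f x u v).
Proof.
have [D [M [DM aD]]] := kernel_dominated coef_pd coef_finite_sum u v.
have [s us] := dominated_unif_sum DM aD.
suff -> : f x u v = s x by exact: unif_sum_has_sum us.
have cs := unif_sum_cts (t := fun phi => coef phi u v) us.
have bs : biK s.
  split=> //; apply: (has_sum_invariant (t := fun phi => coef phi u v)) => z.
  exact: (unif_sum_has_sum z us).
have bf := Psharp_biK u v; have [cf _] := bf.
apply/eqP; rewrite -subr_eq0; apply/eqP.
apply: (Z_complete (r := fun y => f y u v - s y)) => [|phi Zphi]; first exact: biKB.
have cphi := Z_cts Zphi.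
rewrite ipBl// (Z_coefficient (t := fun phi => coef phi u v) cs Zphi us).
by rewrite /coef mulrAC -rmorphM/= mulVf ?gt_eqF ?Z_nsq_gt0// mul1r subrr.
Qed.

End Expansion.

End GelfandPair.

Theorem theorem8p2 (R : realType) (G : ptopologicalType)
  (Gs : compact_group G)
  (mu : probability (Borel G) R) (hmu : is_haar Gs mu)
  (K : set G) (hK : closed_subgroup Gs K)
  (nu : probability (Borel G) R) (hnu : is_haar_on Gs K nu)
  (hGK : gelfand_pair Gs mu K)
  (X : Type) (hX : inhabited X) (f : G -> X -> X -> R[i]) :
  (Psharp Gs K f <-> exists B, series_rep Gs nu f B) /\
  (Psharp Gs K f -> forall B, series_rep Gs nu f B ->
     forall phi, Zset Gs nu phi -> forall u v,
       exists n : nat, span_dim Gs phi n /\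
         B phi u v = n%:R * cint mu (fun x => f x u v * (phi x)^*)).
Proof.
split; first split=> [Pf|[B [Bpd Bfin hs]]].
- exists (coef mu f); split.
  + by move=> phi Zphi; exact: (coef_pd hmu hK hnu hGK Pf Zphi).
  + by move=> u; exact: (coef_finite_sum hmu hK hnu hGK Pf).
  + by move=> x u v; exact: (coef_has_sum hmu hK hnu hGK Pf).
- exact: (series_Psharp hmu hK hnu Bpd Bfin hs).
- move=> _ B [Bpd Bfin hs] phi Zphi u v.
  (* The identity [n%:R * nsq phi = 1] cancels the squared norm in [series_coefficient]. *)
  have [n [dim_n n_nsq]] := Z_span_dim hmu hK hnu Zphi.
  exists n; split=> //.
  rewrite -[cint _ _]/(ip mu (fun x => f x u v) phi).
  rewrite (series_coefficient hmu hK hnu hGK Bpd Bfin u v Zphi hs).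
  have nn : n%:R * (nsq mu phi)%:C = 1.
    by rewrite -(rmorph_nat (real_complex R)) -rmorphM/= n_nsq.
  by rewrite mulrCA nn mulr1.
Qed.
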